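(* Let $d>1$ and $n \geq 1$ be integers, and let $q$ be a power of an odd prime $p$ such that $q^n \equiv 1 \pmod{2d}$ and $q>(n-1)^2$. Consider the $d$-Paley graph $GP(q^n,d)$. If the subfield $\mathbb{F}_q \subseteq \mathbb{F}_{q^n}$ is a maximal subfield clique in $GP(q^n,d)$, then $\mathbb{F}_q$ is also a maximal clique in $GP(q^n,d)$.
   Context: For an abelian group $G$ and $S \subset G\setminus\{0\}$ with $S=-S$, the Cayley graph $\operatorname{Cay}(G,S)$ has vertex set $G$, with $g,h$ adjacent iff $g-h\in S$. For an integer $d>1$ and a prime power $Q \equiv 1 \pmod{2d}$, the $d$-Paley graph $GP(Q,d)$ is $\operatorname{Cay}(\mathbb{F}_Q^+, (\mathbb{F}_Q^* )^d)$, where $\mathbb{F}_Q^+$ is the additive group of $\mathbb{F}_Q$ and $(\mathbb{F}_Q^* )^d$ is the set of nonzero $d$-th powers in $\mathbb{F}_Q$. A clique is a set of pairwise adjacent vertices; a maximal clique is a clique not contained in a strictly larger clique. For a Cayley graph on $\mathbb{F}_{Q}^+$, a subfield clique is a clique that is a subfield of $\mathbb{F}_Q$, and a maximal subfield clique is a subfield clique not contained in a strictly larger subfield clique. *)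

(* Defs.v *)
From HB Require Import structures.
From mathcomp Require Import all_boot all_order all_algebra all_fingroup all_solvable all_field.

Set Implicit Arguments.
Unset Strict Implicit.
Unset Printing Implicit Defensive.

Import GRing.Theory.
Local Open Scope ring_scope.

(* Simple graphs are adjacency relations on a finite vertex type; Cay S is
   irreflexive and symmetric as soon as 0 \notin S and S = -S. *)
Definition Cay (G : finZmodType) (S : {set G}) : rel G :=
  fun g h => g - h \in S.

Definition nonzero_powers (F : finFieldType) (d : nat) : {set F} :=
  [set x ^+ d | x : F & x != 0].

(* The d-Paley graph GP(Q, d), with F the field of order Q. *)
Definition GP (F : finFieldType) (d : nat) : rel F :=
  Cay (nonzero_powers F d).
Arguments GP : clear implicits.

Definition clique (T : finType) (e : rel T) (C : {set T}) : Prop :=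
  {in C &, forall x y, x != y -> e x y}.

Definition maximal_clique (T : finType) (e : rel T) (C : {set T}) : Prop :=
  clique e C /\ forall D : {set T}, clique e D -> ~~ (C \proper D).

(* 1 \in K and K is stable under x - y and x / y. *)
Definition is_subfield (F : finFieldType) (K : {set F}) : Prop :=
  divring_closed (R := F) K.

Definition subfield_clique (F : finFieldType) (e : rel F) (K : {set F}) : Prop :=
  is_subfield K /\ clique e K.

Definition maximal_subfield_clique
    (F : finFieldType) (e : rel F) (K : {set F}) : Prop :=
  subfield_clique e K /\
  forall L : {set F}, subfield_clique e L -> ~~ (K \proper L).

Lemma nonzero_powers_neq0 (F : finFieldType) (d : nat) :
  0 \notin nonzero_powers F d.
Proof.
apply/imsetP => -[x]; rewrite inE => nz_x /esym/eqP.
by rewrite expf_eq0 (negbTE nz_x) andbF.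
Qed.

Lemma nonzero_powersN (F : finFieldType) (d : nat) :
  (1 < d)%N -> #|F| = 1 %[mod 2 * d] ->
  [set - x | x in nonzero_powers F d] = nonzero_powers F d.
Proof.
move=> d_gt1 modF; have d_gt0 := ltnW d_gt1.
have F_gt1 : (1 < #|F|)%N := finNzRing_gt1 F.
have [y nz_y yd] : exists2 y : F, y != 0 & y ^+ d = -1.
  have /dvdnP[m Fm] : (2 * d %| #|F|.-1)%N.
    by rewrite -subn1 -eqn_mod_dvd ?(ltnW F_gt1) //; apply/eqP.
  pose N := #|F|.-1; have N_gt0 : (0 < N)%N by rewrite /N -subn1 subn_gt0.
  have : has N.-primitive_root [seq x <- enum F | x != 0].
    apply: has_prim_root => //.
    - apply/allP => x; rewrite mem_filter => /andP[nz_x _].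
      rewrite unity_rootE -(inj_eq (mulfI nz_x)) mulr1 -exprS prednK ?(ltnW F_gt1) //.
      by rewrite expf_card.
    - by rewrite filter_uniq ?enum_uniq.
    - rewrite size_filter -sum1_count big_enum_cond /= sum1_card /N.
      by rewrite -(cardC1 (0 : F)); apply: subset_leq_card; apply/subsetP.
  case/hasP => z; rewrite mem_filter => /andP[nz_z _] prim_z.
  exists (z ^+ m); first by rewrite expf_neq0.
  have NE : N = (m * d * 2)%N by rewrite /N Fm (mulnC 2%N) mulnA.
  have : (z ^+ (m * d)) ^+ 2 == 1 by rewrite -exprM -NE prim_expr_order.
  rewrite sqrf_eq1 -exprM => /orP[|/eqP//].
  rewrite -(prim_order_dvd prim_z) NE => /dvdn_leq.
  have md_gt0 : (0 < m * d)%N by move: N_gt0; rewrite NE muln_gt0 => /andP[].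
  by rewrite md_gt0 => /(_ isT); rewrite leqNgt ltn_Pmulr.
apply/setP => u; apply/imsetP/imsetP => -[x].
  case/imsetP => w; rewrite inE => nz_w -> ->; exists (w * y).
    by rewrite inE mulf_neq0.
  by rewrite exprMn yd mulrN1.
rewrite inE => nz_x ->; exists ((x * y) ^+ d).
  by apply/imsetP; exists (x * y); rewrite ?inE ?mulf_neq0.
by rewrite exprMn yd mulrN1 opprK.
Qed.

(* Main.v *)
Require Import Defs.
From HB Require Import structures.
From mathcomp Require Import all_boot all_order all_algebra all_fingroup all_solvable all_field.
From mathcomp Require Import zify ring.

(* Suppose [v] extends the clique [K] of order [q], and let [L = K(v)], of degree [m] over [K].
   Unless all of [L^*] is made of [d]-th powers, some character [chi] of [L^*] of order [l > 1] is
   trivial on every [v + a], [a] in [K]. The sums of [chi (f v)] over the monic [f] of degree [i]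
   over [K] are the coefficients of a polynomial [\prod (1 - w X)] with at most [m - 1] factors,
   and the coefficient of [X] is [q], so [q <= (m - 1) max |w|]. The power sums of the [w] are
   character sums over the extensions of [K], and Bombieri's version of Stepanov's method bounds
   these by a constant times the square root of the order of the field; hence [|w|^2 <= q] and
   [q <= (m - 1)^2], contradicting [q > (n - 1)^2]. So [L] is a subfield clique larger than [K]. *)

Set Implicit Arguments.
Unset Strict Implicit.
Unset Printing Implicit Defensive.

Import Order.TTheory GRing.Theory Num.Theory.

(** * Stepanov's method *)

Section Stepanov.
Local Open Scope ring_scope.

(** Three limits of Stepanov's method shape the proof. It needs a field whose order is the square of
    a power of the characteristic, so the character sums are taken only over extensions of [L] of
    even degree [2 t]. They give the power sums of the [w] at the multiples of [2 m], which is
    enough: the bound on [|w|] comes from their growth in [t], so the constant may be crude. It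
    bounds only from above the number of points where the character takes a given nonzero value. As
    these numbers add up to almost the whole field, none of them can be much too small either. Its
    constant depends on the degree of the polynomial inside the character, which must therefore stay
    fixed while [t] grows. Over the extension of degree [2 t] the character is that of [L] composed
    with the norm, and its argument is the norm of a polynomial whose degree depends only on [q] and
    [m]. The sections on the Weil bound write [F] for [L] and [n] for [m]. *)

Lemma sum_distinct_sizes_neq0 (R : nzRingType) (I : finType) (P : I -> {poly R})
    (i0 : I) :
  P i0 != 0 ->
  (forall i j, P i != 0 -> P j != 0 -> size (P i) = size (P j) -> i = j) ->
  \sum_i P i != 0.
Proof.
move=> nz0 inj.
pose i1 := [arg max_(i > i0 | P i != 0) size (P i)].
have [nz1 max1] : P i1 != 0 /\ forall i, P i != 0 -> (size (P i) <= size (P i1))%N.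
  by rewrite /i1; case: arg_maxnP => // i Pi mx; split.
apply/eqP => /(congr1 (fun p : {poly R} => p`_(size (P i1)).-1)).
rewrite coef_sum coef0 (bigD1 i1) //= big1 ?addr0.
  by move/eqP; rewrite -lead_coefE lead_coef_eq0 (negbTE nz1).
move=> i ne_i; have [->|nzi] := eqVneq (P i) 0; first by rewrite coef0.
apply: nth_default.
have ne_sz : size (P i) != size (P i1) by apply: contraNneq ne_i => /inj->.
have lt_sz : (size (P i) < size (P i1))%N by rewrite ltn_neqAle ne_sz max1.
by rewrite -ltnS prednK // (leq_trans _ lt_sz).
Qed.

Lemma card_lt_collision (T U : finType) (h : T -> U) :
  (#|U| < #|T|)%N -> exists x y, x != y /\ h x = h y.
Proof.
move=> lt_UT; have /injectivePn[x [y ne_xy eq_xy]] : ~~ injectiveb h.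
  by apply: contraL lt_UT => /injectiveP/leq_card; rewrite -leqNgt.
by exists x, y.
Qed.

Lemma coprime_muln_modn_inj (m l i j : nat) :
  coprime m l -> (i < l)%N -> (j < l)%N -> m * i = m * j %[mod l] -> i = j.
Proof.
move=> co_ml; wlog le_ij : i j / (i <= j)%N => [wl lt_i lt_j eq_ij|].
  by case/orP: (leq_total i j) => ?; [|symmetry]; apply: wl.
move=> lt_i lt_j /esym/eqP; rewrite eqn_mod_dvd ?leq_mul2l ?le_ij ?orbT //.
rewrite -mulnBr Gauss_dvdr 1?coprime_sym // => /dvdnP[k jk].
by case: k jk => [|k]; nia.
Qed.

Section Bound.

Variables (F : finFieldType) (s l E M : nat) (f : {poly F}).
Hypotheses (cardF : #|F| = (s ^ 2)%N) (s_char : [pchar F].-nat s).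
Hypotheses (l_gt0 : (0 < l)%N) (lE : (s ^ 2 = (l * E).+1)%N).
Hypotheses (size_f : size f = M.+1) (co_Ml : coprime M l).

(* [c i] is the ceiling of [i s / l]; wherever [f ^ E = 1], [f ^ (c i s) = f ^ (b i)]. *)
Let c i := ((i * s + l.-1) %/ l)%N.
Let b i := (c i * s - i * E)%N.

Let c_bounds i : (i * s <= l * c i < i * s + l)%N.
Proof.
rewrite /c; have := divn_eq (i * s + l.-1) l.
have := ltn_pmod (i * s + l.-1) l_gt0.
set m := (_ %% _)%N; set d := (_ %/ _)%N; lia.
Qed.

Let b_def i : (c i * s = b i + i * E)%N.
Proof.
rewrite /b subnK //; have /andP[le1 _] := c_bounds i.
rewrite -(leq_pmul2l l_gt0).
have : (i * s * s <= l * c i * s)%N by rewrite leq_mul2r le1 orbT.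
by move: lE; nia.
Qed.

Let b_eq i : (l * b i = s * (l * c i - i * s) + i)%N.
Proof.
have /andP[le1 _] := c_bounds i; have := b_def i; move: lE.
have : (i * s * s <= l * c i * s)%N by rewrite leq_mul2r le1 orbT.
rewrite mulnBr; nia.
Qed.

Let c_le i : (i < l)%N -> (c i <= s)%N.
Proof. by move=> lt_il; have := c_bounds i; nia. Qed.

Let b_le i : (i < l)%N -> (b i <= s)%N.
Proof.
move=> lt_il; have := b_eq i; have /andP[le1 lt1] := c_bounds i.
have : (s * (l * c i - i * s) <= s * l.-1)%N by rewrite leq_mul2l; lia.
nia.
Qed.

Let s_gt0 : (0 < s)%N.
Proof. by move: lE; case: s => // ; rewrite exp0n. Qed.

(* The points where [f ^ E = 1] are zeros of some [h = \sum t_(a,i) 'X^(a s) f^(c i)]: since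
   [x ^ (s ^ 2) = x], the value of [h ^ s] there is that of [\sum t_(a,i)^s 'X^a f^(b i)], whose
   degree is so small that it vanishes for some nonzero [t] by the pigeonhole principle, whereas
   [h] is nonzero because its terms have distinct degrees. *)
Lemma auxiliary_zeros_bound (A B : nat) :
  (l * (B + M) <= s)%N -> (s * (B + M) + A < A * l * B)%N ->
  (#|[set x | f.[x] ^+ E == 1%R]| <= B + (A + M) * s)%N.
Proof.
move=> leB ltAB; set S := [set x | _].
pose I := ('I_A * 'I_l)%type.
(* All [delta t] have size at most [D], while [t] has [A * l * B] free coefficients: the second
   hypothesis is the inequality that the pigeonhole principle asks for. *)
pose D := (s * (B + M) + A)%N.
have B_gt0 : (0 < B)%N by case: (posnP B) ltAB => // ->; rewrite muln0 ltn0.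
have A_gt0 : (0 < A)%N by case: (posnP A) ltAB => // ->; rewrite !mul0n ltn0.
have nz_f : f != 0 by rewrite -size_poly_eq0 size_f.
have size_fX k : size (f ^+ k) = (k * M).+1.
  have := size_exp f k; rewrite size_f /= mulnC.
  have : (0 < size (f ^+ k))%N by rewrite size_poly_gt0 expf_neq0.
  by case: size => // m _ /= ->.
have polyB (p q : {poly F}) : (p - q) ^+ s = p ^+ s - q ^+ s.
  have cp : [pchar {poly F}].-nat s by rewrite (eq_pnat _ (@pchar_poly F)).
  have := exprDn_pchar (p - q) q cp; rewrite subrK => ->.
  by rewrite addrK.
pose term (t : {poly F}) (u : I) := t ^+ s * 'X^(u.1) * f ^+ b u.2.
pose delta (t : {ffun I -> {poly_B F}}) : {poly F} := \sum_u term (t u) u.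
have size_delta t : (size (delta t) <= D)%N.
  apply: (leq_trans (size_sum _ _ _)); apply/bigmax_leqP => u _.
  rewrite /term; have lt1 := ltn_ord u.1.
  have le2 := b_le (ltn_ord u.2).
  have szt := size_npoly (t u).
  have le1 : (size (term (t u) u) <= (B.-1 * s).+1 + u.1 + b u.2 * M)%N.
    apply: (leq_trans (size_polyMleq _ _)); rewrite size_fX /= addnS /= leq_add2r.
    apply: (leq_trans (size_polyMleq _ _)); rewrite size_polyXn addnS /= leq_add2r.
    apply: (leq_trans (size_poly_exp_leq _ _)); rewrite ltnS leq_mul2r.
    by rewrite -!subn1 leq_sub2r ?orbT.
  apply: leq_trans le1 _; rewrite /D; nia.
have [t1 [t2 [ne_t eq_t]]] : exists t1 t2 : {ffun I -> {poly_B F}},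
    t1 != t2 /\ npolyp D (delta t1) = npolyp D (delta t2).
  apply: card_lt_collision; rewrite card_ffun !card_npoly card_prod !card_ord.
  rewrite -expnM ltn_exp2l ?finNzRing_gt1 // mulnC //.
(* Raising to the power [s] is additive, hence so is [delta], and the difference of two colliding
   families lies in its kernel. *)
pose t u : {poly F} := val (t1 u) - val (t2 u).
have eq_delta : \sum_u term (t u) u = 0.
  have /(congr1 val)/= := eq_t; rewrite !npolypK // => eqd.
  transitivity (delta t1 - delta t2); last by rewrite eqd subrr.
  rewrite /delta -sumrB; apply: eq_bigr => u _.
  by rewrite /term polyB !mulrBl.
have size_t u : (size (t u) <= B)%N.
  apply: leq_trans (size_polyD _ _) _.
  by rewrite size_polyN geq_max !size_npoly.
pose g u := t u * 'X^(u.1 * s) * f ^+ c u.2.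
have size_g u : g u != 0 -> size (g u) = ((size (t u)).-1 + u.1 * s + c u.2 * M).+1.
  rewrite /g !mulf_eq0 !negb_or => /andP[/andP[nzt nzX] nzf].
  rewrite size_mul ?mulf_neq0 // size_fX addnS /= size_mulXn //.
  have : (0 < size (t u))%N by rewrite size_poly_gt0.
  by case: (size (t u)) => // m _ /=; rewrite addnS addSn (addnC m).
have [u0 nz_u0] : exists u, t u != 0.
  apply/existsP; apply: contraNT ne_t; rewrite negb_exists => /forallP t0.
  apply/eqP/ffunP => u; apply: val_inj; apply/eqP; rewrite -subr_eq0.
  by have := t0 u; rewrite negbK.
have nz_h : \sum_u g u != 0.
  apply: (@sum_distinct_sizes_neq0 _ _ _ u0) => [|[a i] [a' i']].
    by rewrite /g !mulf_neq0 // ?expf_neq0 // polyX_eq0.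
  move=> nzi nzj; rewrite !size_g //= => -[eq_sz].
  have := size_t (a, i); have := size_t (a', i'); move: eq_sz.
  have : t (a, i) != 0 by apply: contraNneq nzi => t0; rewrite /g t0 !mul0r.
  have : t (a', i') != 0 by apply: contraNneq nzj => t0; rewrite /g t0 !mul0r.
  rewrite -!size_poly_gt0.
  set sj := size _; set si := size _ => sj_gt0 si_gt0 eq_sz le_sj le_si.
  have /andP[ci1 ci2] := c_bounds i; have /andP[cj1 cj2] := c_bounds i'.
  have lti := ltn_ord i; have ltj := ltn_ord i'.
  (* Multiplied by [l], the degree of [g (a, i)] is [(l * a + M * i) * s + ri], and the first
     hypothesis gives [ri < s]. Division by [s] recovers [l * a + M * i]; modulo [l] this determines
     [i], since [M] is coprime to [l], and then [a]. *)
  pose ri := (l * si.-1 + M * (l * c i - i * s))%N.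
  pose rj := (l * sj.-1 + M * (l * c i' - i' * s))%N.
  have eqrs : ((l * a + M * i) * s + ri = (l * a' + M * i') * s + rj)%N.
    rewrite /ri /rj !mulnBr.
    have : (M * (i * s) <= M * (l * c i))%N by rewrite leq_mul2l ci1 orbT.
    have : (M * (i' * s) <= M * (l * c i'))%N by rewrite leq_mul2l cj1 orbT.
    nia.
  have lt_r k (m : nat) : (0 < m <= B)%N -> (l * m.-1 + M * (l * c k - k * s) < s)%N.
    case/andP=> m_gt0 le_m; have /andP[_ ck2] := c_bounds k.
    have h1 : (l * m.-1 + l <= l * B)%N by rewrite -mulnSr prednK // leq_mul2l le_m orbT.
    have h2 : (M * (l * c k - k * s) <= l * M)%N.
      by rewrite [(l * M)%N]mulnC leq_mul2l leq_subLR (ltnW ck2) orbT.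
    apply: leq_trans leB; rewrite mulnDr -addSn leq_add //.
    by apply: leq_trans h1; rewrite -addn1 leq_add2l.
  have eqq : (l * a + M * i = l * a' + M * i')%N.
    have := congr1 (divn^~ s) eqrs.
    by rewrite /= !divnMDl // !divn_small ?addn0 // lt_r // ?si_gt0 ?sj_gt0.
  have eqi : i = i'.
    apply: val_inj; apply: (coprime_muln_modn_inj co_Ml) => //.
    by have := congr1 (modn^~ l) eqq; rewrite /= ![(l * _)%N]mulnC !modnMDl.
  move: eqq; rewrite eqi => /addIn/eqP; rewrite eqn_pmul2l // => /eqP/val_inj ->.
  by [].
have roots x : x \in S -> root (\sum_u g u) x.
  rewrite inE => /eqP fx1; have xQ : x ^+ (s * s) = x by rewrite mulnn -cardF expf_card.
  have frob (J : finType) (G : J -> F) : (\sum_j G j) ^+ s = \sum_j (G j) ^+ s.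
    elim/big_rec2: _ => [|j y z _ <-]; first by rewrite expr0n gtn_eqF.
    by rewrite exprDn_pchar.
  have /eqP : (\sum_u g u).[x] ^+ s = 0.
    transitivity (\sum_u term (t u) u).[x]; last by rewrite eq_delta horner0.
    rewrite !horner_sum frob; apply: eq_bigr => -[a i] _; rewrite /g /term /=.
    rewrite !hornerM !horner_exp !hornerX !exprMn -!exprM.
    by rewrite -mulnA (mulnC a) exprM xQ b_def exprD [(i * E)%N]mulnC exprM fx1 expr1n mulr1.
  by rewrite expf_eq0 s_gt0.
have size_h : (size (\sum_u g u)%R <= (B + (A + M) * s).+1)%N.
  apply: leq_trans (size_sum _ _ _) _; apply/bigmax_leqP => u _.
  have [->|nzg] := eqVneq (g u : {poly F}) 0; first by rewrite size_poly0.
  rewrite size_g // ltnS mulnDl addnA leq_add //.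
    by rewrite leq_add ?leq_mul // ?(ltnW (ltn_ord _)) // (leq_trans (leq_pred _)).
  by rewrite mulnC leq_mul // c_le.
rewrite cardE -ltnS; apply: leq_trans size_h.
apply: max_poly_roots => //; last exact: enum_uniq.
by apply/allP => x; rewrite mem_enum => /roots.
Qed.

(** With [w = s %/ l], the parameters are [B = w - M], the largest that the first condition surely
    allows, and [A = w + (2 * M + 3)], where the excess over [w] pays for the loss [M] in [B] and
    for the rounding in [w]. If [s] is too small for this choice, the trivial bound [s ^ 2] is
    absorbed by the last term of the constant. *)
Lemma stepanov_bound :
  (l * #|[set x | f.[x] ^+ E == 1%R]|
     <= s ^ 2 + s * (1 + l * (3 * M + 3) + l * (2 * l * M.+1)))%N.
Proof.
set N := #|_|; have [lt_s|le_s] := ltnP s (2 * l * M.+1).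
  have : (N <= s ^ 2)%N by rewrite -cardF max_card.
  rewrite -mulnn => leN; have : (l * N <= l * (s * s))%N by rewrite leq_mul2l leN orbT.
  have : (l * (s * s) <= s * (l * (2 * l * M.+1)))%N.
    by rewrite mulnCA leq_mul2l leq_mul2l (ltnW lt_s) !orbT.
  by rewrite !mulnDr; lia.
have := divn_eq s l; have := ltn_pmod s l_gt0.
set w := (s %/ l)%N; set m := (s %% l)%N => lt_m s_eq.
have M_le_w : (M < w)%N by nia.
have [B w_eq] : exists B, w = (B + M)%N by exists (w - M)%N; rewrite subnK // ltnW.
have : (N <= B + (w + (2 * M + 3) + M) * s)%N.
  apply: auxiliary_zeros_bound; first by rewrite -w_eq s_eq mulnC leq_addr.
  rewrite -w_eq.
  set C := (2 * M + 3)%N.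
  have : (s <= l * B + l * M.+1)%N by nia.
  have : (w * l <= s)%N by lia.
  move: le_s; rewrite /C; nia.
move=> leN; have : (l * N <= l * (B + (w + (2 * M + 3) + M) * s))%N by rewrite leq_mul2l leN orbT.
rewrite -mulnn; nia.
Qed.
End Bound.
End Stepanov.

(** * Power sums *)

Section PowerSums.
Local Open Scope ring_scope.

(** Division by [1 - w X] is multiplication by the geometric series of [w X]. *)
Lemma coef_cofactor (R : comNzRingType) (w : R) (A B : {poly R}) :
  A = (1 - w *: 'X) * B -> forall j, B`_j = \sum_(r < j.+1) w ^+ r * A`_(j - r).
Proof.
move=> AB; elim=> [|j IHj].
  by rewrite big_ord1 AB mulrBl mul1r -scalerAl -!mul_polyC coefB coefCM coefXM mulr0 subr0 mul1r.
rewrite big_ord_recl expr0 mul1r subn0.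
have -> : A`_j.+1 = B`_j.+1 - w * B`_j.
  by rewrite AB mulrBl mul1r -scalerAl coefB coefZ coefXM.
rewrite IHj mulr_sumr -[LHS]addr0 -addrA; congr (_ + _); apply/esym/eqP.
rewrite addrC subr_eq0; apply/eqP/eq_bigr => r _.
by rewrite mulrA -exprS subSS.
Qed.

(** Newton's identities, read off the derivative of the product: [B w] stands for [A / (1 - w X)],
    whose coefficients are those of a geometric series times [A]. *)
Lemma newton_power_sums (R : comNzRingType) (ws : seq R) (A := \prod_(w <- ws) (1 - w *: 'X)) j :
  j.+1%:R * A`_j.+1 = - \sum_(r < j.+1) (\sum_(w <- ws) w ^+ r.+1) * A`_(j - r).
Proof.
have -> : \sum_(r < j.+1) (\sum_(w <- ws) w ^+ r.+1) * A`_(j - r) =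
    \sum_(w <- ws) \sum_(r < j.+1) w * (w ^+ r * A`_(j - r)).
  rewrite exchange_big /=; apply: eq_bigr => r _.
  by rewrite mulr_suml; apply: eq_bigr => w _; rewrite exprS mulrA.
suff [B [AB dA]] : exists B : R -> {poly R},
    {in ws, forall w, A = (1 - w *: 'X) * B w} /\ A^`() = - \sum_(w <- ws) w *: B w.
  rewrite mulr_natl -coef_deriv dA coefN coef_sum; congr (- _).
  rewrite big_seq [RHS]big_seq; apply: eq_bigr => w /AB Aw.
  by rewrite coefZ (coef_cofactor Aw) mulr_sumr.
rewrite {}/A; elim: ws => [|w ws [B [AB dA]]].
  exists (fun=> 0); split=> //; rewrite !big_nil derivC oppr0 //.
set A := \prod_(w <- ws) _ in AB dA.
(* A cofactor depends on the value [u] only, not on its position; if [w] already occurs in [ws],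
   both branches agree because [A = (1 - w X) * B w]. *)
pose B' u := if u == w then A else (1 - w *: 'X) * B u.
have B'E : {in ws, forall u, B' u = (1 - w *: 'X) * B u}.
  by rewrite /B' => u /AB; case: eqP => // ->.
exists B'; rewrite !big_cons -/A; split=> [u|].
  rewrite inE; have [-> _|ne_u /= u_ws] := eqVneq u w; first by rewrite /B' eqxx.
  by rewrite B'E // {1}(AB _ u_ws) mulrCA.
rewrite derivM derivB derivZ derivX derivC sub0r dA.
rewrite {1}/B' eqxx mulNr -scalerAl mul1r opprD mulrN; congr (- _ - _).
rewrite mulr_sumr big_seq [RHS]big_seq; apply: eq_bigr => u u_ws.
by rewrite B'E // scalerAr.
Qed.

Lemma one_add_expr_ge (R : numDomainType) (x : R) n : 0 <= x -> 1 + n%:R * x <= (1 + x) ^+ n.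
Proof.
move=> x_ge0; elim: n => [|n IHn]; first by rewrite mul0r addr0 expr0.
rewrite exprS; apply: le_trans (ler_wpM2l _ IHn); last by rewrite addr_ge0.
rewrite mulrDl mul1r mulrDr mulr1 -natr1 mulrDl mul1r !addrA.
rewrite [1 + n%:R * x + x + _]addrC -subr_ge0 addrK.
by rewrite mulr_ge0 // mulr_ge0 // ler0n.
Qed.

(** [Lam] vanishes at all entries other than [w0], so a fixed combination of consecutive power sums
    isolates [w0 ^ t.+1], times a nonzero constant. Hence the powers of [|w0| / B] stay bounded, and
    by Bernoulli's inequality this ratio cannot exceed 1. *)
Lemma power_sum_bound (ws : seq algC) (C B : algC) :
  0 < B -> (forall t, `|\sum_(w <- ws) w ^+ t.+1| <= C * B ^+ t.+1) ->
  {in ws, forall w, `|w| <= B}.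
Proof.
move=> B_gt0 bnd w0 w0_ws; rewrite real_leNgt ?normr_real ?gtr0_real //.
apply/negP => lt_Bw.
pose Lam : {poly algC} := \prod_(w <- undup ws | w != w0) ('X - w%:P).
have Lam0 w : w \in ws -> w != w0 -> Lam.[w] = 0.
  move=> w_ws ne_w; apply/eqP; rewrite /Lam horner_prod prodf_seq_eq0.
  by apply/hasP; exists w; rewrite ?mem_undup // ne_w !hornerE subrr eqxx.
have nzLam : Lam.[w0] != 0.
  rewrite /Lam horner_prod prodf_seq_neq0; apply/allP => w _.
  by rewrite !hornerE subr_eq0 eq_sym; apply/implyP.
have key t : (count_mem w0 ws)%:R * (w0 ^+ t.+1 * Lam.[w0]) =
    \sum_(k < size Lam) Lam`_k * \sum_(w <- ws) w ^+ (t + k).+1.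
  transitivity (\sum_(w <- ws) w ^+ t.+1 * Lam.[w]).
    rewrite (bigID (pred1 w0)) /= [X in _ + X]big1_seq ?addr0; last first.
      by move=> w /andP[ne_w w_ws]; rewrite Lam0 ?mulr0.
    rewrite (eq_bigr (fun=> w0 ^+ t.+1 * Lam.[w0])); last by move=> w /eqP->.
    by rewrite big_const_seq iter_addr_0 mulr_natl.
  rewrite (eq_bigr (fun w => \sum_(k < size Lam) Lam`_k * w ^+ (t + k).+1)).
    by rewrite exchange_big; apply: eq_bigr => k _; rewrite mulr_sumr.
  move=> w _; rewrite horner_coef mulr_sumr; apply: eq_bigr => k _.
  by rewrite mulrCA -exprD addSn.
pose c := `|Lam.[w0]|; pose C2 := \sum_(k < size Lam) `|Lam`_k| * (C * B ^+ k).
have c_gt0 : 0 < c by rewrite normr_gt0.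
have le_pow t : c * `|w0| ^+ t.+1 <= C2 * B ^+ t.+1.
  apply: (@le_trans _ _ `|(count_mem w0 ws)%:R * (w0 ^+ t.+1 * Lam.[w0])|).
    rewrite !normrM normrX [c * _]mulrC normr_nat -[X in X <= _]mul1r; apply: ler_wpM2r.
      by rewrite mulr_ge0 ?exprn_ge0 ?normr_ge0.
    by rewrite ler1n -has_count has_pred1.
  rewrite key; apply: le_trans (ler_norm_sum _ _ _) _.
  rewrite /C2 mulr_suml; apply: ler_sum => k _; rewrite normrM -mulrA.
  apply: ler_wpM2l => //; apply: le_trans (bnd _) _.
  by rewrite -mulrA -exprD addnS addnC.
pose x := `|w0| / B - 1.
have x_gt0 : 0 < x by rewrite subr_gt0 ltr_pdivlMr // mul1r.
have le_x t : c * (t.+1%:R * x) <= C2.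
  have : c * (1 + x) ^+ t.+1 <= C2.
    by rewrite /x subrKC expr_div_n mulrA ler_pdivrMr ?exprn_gt0.
  apply: le_trans; rewrite ler_pM2l //.
  by apply: le_trans (one_add_expr_ge _ (ltW x_gt0)); rewrite lerDr.
have C2_ge0 : 0 <= C2.
  by rewrite (le_trans _ (le_x 0%N)) // !mulr_ge0 ?ler0n ?(ltW c_gt0) ?(ltW x_gt0).
have cx_gt0 : 0 < c * x by rewrite mulr_gt0.
have := archi_boundP (divr_ge0 C2_ge0 (ltW cx_gt0)); rewrite ltr_pdivrMr //.
case: (Num.bound _) => [|t]; first by rewrite mul0r => /lt_geF; rewrite C2_ge0.
by rewrite mulrCA => /(le_lt_trans (le_x t)); rewrite ltxx.
Qed.

Lemma factor_one_sub (A : {poly algC}) :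
  A`_0 = 1 ->
  exists2 ws : seq algC, A = \prod_(w <- ws) (1 - w *: 'X) & size ws = (size A).-1.
Proof.
move=> A0; have nzA : A != 0.
  by apply/eqP => A_0; move/eqP: A0; rewrite A_0 coef0 eq_sym oner_eq0.
have [rs Ars] := closed_field_poly_normal A.
have nz_rs r : r \in rs -> r != 0.
  move=> r_rs; apply: contra_eq_neq A0 => r0.
  rewrite -horner_coef0 Ars hornerZ horner_prod (big_rem r) //= hornerXsubC r0 subrr mul0r mulr0.
  by rewrite eq_sym oner_neq0.
exists [seq r^-1 | r <- rs].
  have eq_prod : \prod_(r <- rs) ('X - r%:P) =
      (\prod_(r <- rs) (- r)) *: \prod_(r <- rs) (1 - r^-1 *: 'X).
    rewrite -mul_polyC rmorph_prod -big_split /= big_seq [RHS]big_seq.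
    apply: eq_bigr => r /nz_rs nzr.
    by rewrite mulrBr mulr1 -mul_polyC mulrA -polyCM mulNr mulfV //
      polyCN polyCN polyC1 mulN1r opprK addrC.
  have h := A0; rewrite Ars eq_prod scalerA in h.
  rewrite big_map {1}Ars eq_prod scalerA.
  suff -> : lead_coef A * \prod_(r <- rs) (- r) = 1 by rewrite scale1r.
  rewrite -horner_coef0 hornerZ horner_prod in h.
  rewrite -[RHS]h [X in _ = _ * X]big1 ?mulr1 // => r _.
  by rewrite !hornerE ?mulr0 ?subr0.
rewrite size_map Ars size_scale ?lead_coef_eq0 // size_prod_XsubC //.
Qed.

End PowerSums.

(** * Monic polynomials and the L-function *)

Section MonicPolynomials.
Local Open Scope ring_scope.
Variable k : finFieldType.
Implicit Types (f g P : {poly k}) (d N : nat).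

Definition pdeg f := (size f).-1.

Definition monics d : seq {poly k} := [seq 'X^d + val t | t <- enum {: {poly_d k}}].

Lemma mem_monics d f : (f \in monics d) = (f \is monic) && (size f == d.+1).
Proof.
have size_add (t : {poly_d k}) : size ('X^d + val t) = d.+1.
  by rewrite size_polyDl ?size_polyXn // ltnS size_npoly.
apply/mapP/andP => [[t _ ->]|[mon_f /eqP szf]].
  rewrite size_add eqxx; split=> //.
  by rewrite monicE lead_coefDl ?lead_coefXn // size_polyXn ltnS size_npoly.
have szt : (size (f - 'X^d)%R <= d)%N.
  apply/leq_sizeP => i; rewrite leq_eqVlt => /orP[/eqP<-|lt_i].
    rewrite coefB coefXn eqxx; move: mon_f; rewrite monicE lead_coefE szf /= => /eqP->.
    by rewrite subrr.
  by rewrite coefB coefXn gtn_eqF // subr0 nth_default // szf.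
by exists (NPoly szt); rewrite ?mem_enum //= subrKC.
Qed.

Lemma monics_uniq d : uniq (monics d).
Proof. by rewrite map_inj_uniq ?enum_uniq // => t u /addrI/val_inj. Qed.

Lemma monics0 : monics 0 = [:: 1].
Proof.
apply: perm_small_eq => //; apply: uniq_perm; rewrite ?monics_uniq // => f.
rewrite mem_monics inE; apply/andP/eqP => [[mon_f szf]|->]; last by rewrite monic1 size_poly1.
have /size_poly1P[c _ fc] := szf; move: mon_f; rewrite fc monicE lead_coefC => /eqP->.
by rewrite polyC1.
Qed.

Lemma monic_pdeg f : f \is monic -> size f = (pdeg f).+1.
Proof. by move=> mon_f; rewrite /pdeg prednK // size_poly_gt0 monic_neq0. Qed.

Lemma pdegM f g : f \is monic -> g \is monic -> pdeg (f * g) = (pdeg f + pdeg g)%N.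
Proof.
move=> mf mg; rewrite /pdeg size_monicM ?monic_neq0 //.
by rewrite (monic_pdeg mf) (monic_pdeg mg) addnS.
Qed.

Lemma pdegX f e : f \is monic -> pdeg (f ^+ e) = (e * pdeg f)%N.
Proof. by move=> mf; rewrite /pdeg size_exp mulnC. Qed.

Definition irr_monics N : seq {poly k} :=
  [seq f <- flatten [seq monics d | d <- iota 1 N] | irreducibleb f].

Lemma mem_irr_monics N f :
  (f \in irr_monics N) = [&& f \is monic, irreducibleb f & (pdeg f <= N)%N].
Proof.
rewrite mem_filter andbC; case irrf: (irreducibleb f); last by rewrite !andbF.
rewrite andbT /=; apply/flatten_mapP/andP => [[d]|[mon_f le_N]].
  rewrite mem_iota mem_monics /pdeg => /andP[d_gt0 le_d] /andP[-> /eqP->].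
  by split=> //; rewrite /= -ltnS addnC -[(N.+1)%N]addn1.
exists (pdeg f); last by rewrite mem_monics mon_f monic_pdeg ?eqxx.
by rewrite mem_iota add1n ltnS le_N andbT /pdeg -subn1 subn_gt0; case/andP: irrf.
Qed.

Lemma irr_monics_uniq N : uniq (irr_monics N).
Proof.
apply: filter_uniq; elim: N 1%N => [|N IHN] m //=.
rewrite cat_uniq monics_uniq IHN andbT /=; apply/hasPn => f /flatten_mapP[d].
rewrite mem_iota => /andP[lt_md _]; rewrite !mem_monics => /andP[_ /eqP->].
by rewrite eqSS gtn_eqF // andbF.
Qed.

Lemma irr_pdeg_gt0 f : irreducibleb f -> (0 < pdeg f)%N.
Proof. by case/andP=> szf _; rewrite /pdeg -subn1 subn_gt0. Qed.

Lemma irr_monic_dvdp f : (1 < size f)%N ->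
  exists P, [/\ P \is monic, irreducibleb P & P %| f].
Proof.
have [m] := ubnP (size f); elim: m f => // m IHm f le_fm szf.
have [/irreducibleP irrf|] := boolP (irreducibleb f); last first.
  rewrite /irreducibleb szf negb_forall => /existsP[q]; rewrite negb_imply.
  rewrite -Pdiv.Idomain.dvdpE -ltnNge => /andP[dv_qf szq].
  have [] := IHm (q : {poly k}) _ szq.
    by apply: leq_ltn_trans (size_npoly q) _; rewrite -ltnS prednK // (leq_trans _ szf).
  by move=> P [mP iP dv]; exists P; split=> //; apply: dvdp_trans dv_qf.
have nzc : (lead_coef f)^-1 != 0 by rewrite invr_eq0 lead_coef_eq0 irredp_neq0.
exists ((lead_coef f)^-1 *: f); split.
- by rewrite monicE lead_coefZ mulVf // -invr_eq0.
- apply/irreducibleP; split=> [|q szq]; first by rewrite size_scale.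
  rewrite dvdpZr // => /(irrf _ szq); rewrite eqp_sym => eq_q.
  by rewrite eqp_sym (eqp_trans (eqp_scale _ nzc)).
- by rewrite dvdpZl.
Qed.

Lemma irr_monics_coprime f g :
  f \is monic -> g \is monic -> irreducibleb f -> irreducibleb g -> f != g -> coprimep f g.
Proof.
move=> mf mg /irreducibleP irf /irreducibleP irg ne_fg; rewrite irreducible_poly_coprime //.
apply: contra ne_fg => dv_fg; rewrite -eqp_monic //; apply: irg => //.
by have [sz _] := irf; rewrite gtn_eqF.
Qed.

(** Unique factorization, in terms of degrees: the multiplicity of [P] in [f] is the number of
    [e > 0] such that [P ^ e] divides [f]. Removing one factor [P0] shifts the exponents of [P0] by
    one and does not affect those of the other [P]. *)
Lemma pdeg_sum_irr N f : f \is monic -> (pdeg f <= N)%N ->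
  (\sum_(P <- irr_monics N) \sum_(1 <= e < N.+1 | (P ^+ e %| f)%R) pdeg P = pdeg f)%N.
Proof.
have [m] := ubnP (size f); elim: m f => // m IHm f le_fm mf le_fN.
have [sz1|szf] := leqP (size f) 1.
  have f1 : f = 1.
    have : f \in monics 0 by rewrite mem_monics mf eqn_leq sz1 size_poly_gt0 monic_neq0.
    by rewrite monics0 inE => /eqP.
  rewrite f1 {2}/pdeg size_poly1 big1_seq // => P /andP[_].
  rewrite mem_irr_monics => /and3P[mP irP le_N].
  rewrite big_nat_cond big1 // => e /andP[/andP[e_gt0 _]].
  rewrite dvdp1 monic_pdeg ?monic_exp // pdegX // eqSS muln_eq0.
  by rewrite (gtn_eqF e_gt0) (gtn_eqF (irr_pdeg_gt0 irP)).
have [P0 [mP0 irP0 dvP0]] := irr_monic_dvdp szf.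
have d_gt0 := irr_pdeg_gt0 irP0.
have /dvdpP[g fg] := dvP0; rewrite mulrC in fg.
have mg : g \is monic by rewrite -(monicMl _ mP0) -fg.
have deg_f : pdeg f = (pdeg P0 + pdeg g)%N by rewrite fg pdegM.
have lt_gN : (pdeg g < N)%N by rewrite (leq_trans _ le_fN) // deg_f -addn1 addnC leq_add2r.
have P0N : P0 \in irr_monics N.
  by rewrite mem_irr_monics mP0 irP0 (leq_trans _ le_fN) // deg_f leq_addr.
rewrite deg_f -(IHm g) ?(ltnW lt_gN) //; last first.
  by rewrite -ltnS (leq_trans _ le_fm) // ltnS !monic_pdeg // ltnS deg_f -addn1 addnC leq_add2r.
have uP := irr_monics_uniq N.
rewrite (bigD1_seq P0) //= [in RHS](bigD1_seq P0) //= addnA; congr (_ + _)%N; last first.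
  rewrite big_seq_cond [RHS]big_seq_cond; apply: eq_bigr => P /andP[].
  rewrite mem_irr_monics => /and3P[mP irP _] ne_P.
  apply: eq_bigl => e; rewrite fg Gauss_dvdpr // coprimep_expl //.
  exact: irr_monics_coprime.
rewrite big_mkcond [in RHS]big_mkcond /=.
pose G e := if P0 ^+ e %| g then pdeg P0 else 0%N.
(* After the shift the exponents run from 0 to [N - 1]; exponent [N] can be put back since [P0 ^ N]
   has degree larger than [g], and exponent 0 contributes the degree of [P0]. *)
have GN : G N = 0%N.
  rewrite /G; case: ifP => // /dvdp_leq; rewrite monic_neq0 // => /(_ isT).
  rewrite !monic_pdeg ?monic_exp // pdegX // ltnS => le_g.
  by have := leq_trans le_g (ltnW lt_gN); have := leq_pmulr N d_gt0; lia.
transitivity (\sum_(0 <= e < N) G e)%N.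
  rewrite big_add1 /=; apply: eq_bigr => e _.
  by rewrite fg exprS dvdp_mul2l ?monic_neq0.
have -> : (\sum_(0 <= e < N) G e = \sum_(0 <= e < N.+1) G e)%N.
  by rewrite big_nat_recr //= GN addn0.
by rewrite big_ltn // {1}/G expr0 dvd1p.
Qed.

Lemma perm_monics_dvdp g d : g \is monic ->
  perm_eq [seq f <- monics (pdeg g + d) | g %| f] [seq g * h | h <- monics d].
Proof.
move=> mg; apply: uniq_perm; first by rewrite filter_uniq ?monics_uniq.
  by rewrite map_inj_uniq ?monics_uniq //; apply/mulfI/monic_neq0.
move=> f; rewrite mem_filter mem_monics; apply/and3P/mapP => [[/dvdpP[h ->] mf]|[h]].
  have mh : h \is monic by rewrite -(monicMr _ mg).
  rewrite mulrC monic_pdeg ?monicMl // pdegM // eqSS eqn_add2l => /eqP <-.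
  by exists h => //; rewrite mem_monics mh monic_pdeg ?eqxx.
rewrite mem_monics => /andP[mh szh] ->; rewrite dvdp_mulIl monicMl //; split=> //.
by rewrite monic_pdeg ?monicMl // pdegM // eqSS eqn_add2l /pdeg (eqP szh).
Qed.

End MonicPolynomials.

Section LFunction.
Local Open Scope ring_scope.

Lemma sum_multiples (V : nmodType) (e j : nat) (G : nat -> V) : (0 < e)%N ->
  \sum_(1 <= r < j.+1 | (e %| r)%N) G r =
  \sum_(1 <= i < j.+1 | (i * e <= j)%N) G (i * e)%N.
Proof.
move=> e_gt0; rewrite -big_filter -[RHS]big_filter.
rewrite -[RHS](big_map (fun i => (i * e)%N) xpredT G).
apply/perm_big/uniq_perm; first by rewrite filter_uniq ?iota_uniq.
  rewrite map_inj_uniq ?filter_uniq ?iota_uniq // => a b /eqP.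
  by rewrite eqn_pmul2r // => /eqP.
move=> r; rewrite mem_filter mem_index_iota ltnS.
apply/and3P/mapP => [[/dvdnP[i ->] r_gt0 le_r]|[i]].
  exists i => //; rewrite mem_filter mem_index_iota le_r /= ltnS.
  move: r_gt0; rewrite muln_gt0 => /andP[-> _].
  exact: leq_trans (leq_pmulr _ e_gt0) le_r.
rewrite mem_filter mem_index_iota => /and3P[le_ie i_gt0 _] ->.
by rewrite dvdn_mull // muln_gt0 i_gt0 e_gt0.
Qed.

Variables (k : finFieldType) (R : comNzRingType) (chi : {poly k} -> R).
Hypotheses (chi1 : chi 1 = 1) (chiM : {morph chi : f g / f * g}).

Definition Lcoef j := \sum_(f <- monics k j) chi f.

(* The coefficients of the logarithmic derivative of the generating series of [Lcoef], read off
   its Euler product. *)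
Definition Lpower r :=
  \sum_(P <- irr_monics k r | (pdeg P %| r)%N) (chi P ^+ (r %/ pdeg P)) *+ pdeg P.

Lemma Lcoef0 : Lcoef 0 = 1.
Proof. by rewrite /Lcoef monics0 big_seq1. Qed.

Let chiX f e : chi (f ^+ e) = chi f ^+ e.
Proof. by elim: e => [|e IHe]; rewrite ?expr0 // !exprS chiM IHe. Qed.

(** The degree [j] of [f] is the sum of [pdeg P] over the prime powers [P ^ e] dividing [f]. Writing
    [f = P ^ e * h] and summing over [h] first gives the convolution, with [r = e * pdeg P]; this is
    the argument for the von Mangoldt function. *)
Lemma Lcoef_recursion j :
  Lcoef j *+ j = \sum_(1 <= r < j.+1) Lpower r * Lcoef (j - r).
Proof.
transitivity (\sum_(P <- irr_monics k j) \sum_(1 <= e < j.+1)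
    (\sum_(f <- monics k j | P ^+ e %| f) chi f) *+ pdeg P).
  transitivity (\sum_(f <- monics k j) \sum_(P <- irr_monics k j)
      \sum_(1 <= e < j.+1 | P ^+ e %| f) chi f *+ pdeg P).
    rewrite -sumrMnl big_seq [RHS]big_seq; apply: eq_bigr => f.
    rewrite mem_monics => /andP[mf /eqP szf].
    have deg_f : pdeg f = j by rewrite /pdeg szf.
    rewrite -{1}deg_f -(@pdeg_sum_irr _ j) ?deg_f // -sumrMnr.
    by apply: eq_bigr => P _; rewrite -sumrMnr.
  rewrite exchange_big; apply: eq_bigr => P _ /=.
  rewrite (exchange_big_dep xpredT) //=; apply: eq_bigr => e _.
  by rewrite sumrMnl.
transitivity (\sum_(1 <= r < j.+1) \sum_(P <- irr_monics k j | (pdeg P %| r)%N)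
    (chi P ^+ (r %/ pdeg P) *+ pdeg P) * Lcoef (j - r)); last first.
  rewrite big_nat [RHS]big_nat; apply: eq_bigr => r /andP[r_gt0 le_rj].
  rewrite -mulr_suml /Lpower; congr (_ * _).
  rewrite -[LHS]big_filter -[RHS]big_filter; apply/perm_big/uniq_perm.
  - by rewrite filter_uniq ?irr_monics_uniq.
  - by rewrite filter_uniq ?irr_monics_uniq.
  move=> P; rewrite mem_filter [RHS]mem_filter !mem_irr_monics.
  have [dv|] //= := boolP (pdeg P %| r)%N; have le_r := dvdn_leq r_gt0 dv.
  by rewrite le_r (leq_trans le_r).
rewrite [RHS](exchange_big_dep xpredT) //= big_seq [RHS]big_seq; apply: eq_bigr => P.
rewrite mem_irr_monics => /and3P[mP irP _]; have d_gt0 := irr_pdeg_gt0 irP.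
rewrite (sum_multiples _ (fun r => chi P ^+ (r %/ pdeg P) *+ pdeg P * Lcoef (j - r))) //.
rewrite [RHS]big_mkcond; apply: eq_bigr => e _; rewrite mulnK //.
case: leqP => [le_ej|lt_je].
  rewrite -big_filter mulrnAl; congr (_ *+ _).
  have [i ->] : exists i, j = (e * pdeg P + i)%N by exists (j - e * pdeg P)%N; rewrite subnKC.
  rewrite addKn -pdegX // (perm_big _ (perm_monics_dvdp _ _)) ?monic_exp // big_map.
  by rewrite /Lcoef mulr_sumr; apply: eq_bigr => h _; rewrite chiM chiX.
rewrite big1_seq ?mul0rn // => f /andP[/dvdp_leq dv]; rewrite mem_monics => /andP[mf /eqP szf].
move: dv; rewrite monic_neq0 // => /(_ isT).
by rewrite szf monic_pdeg ?monic_exp // pdegX // ltnS leqNgt lt_je.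
Qed.

(** By Newton's identities the negated power sums satisfy the recursion of [Lpower]. It determines
    its solution without any division, as the last term carries the factor [Lcoef 0 = 1]. *)
Lemma Lpower_eq (ws : seq R) :
  (forall j, Lcoef j = (\prod_(w <- ws) (1 - w *: 'X))`_j) ->
  forall r, Lpower r.+1 = - \sum_(w <- ws) w ^+ r.+1.
Proof.
move=> LcoefE.
have rec j : \sum_(r < j.+1) Lpower r.+1 * Lcoef (j - r) =
    \sum_(r < j.+1) (- \sum_(w <- ws) w ^+ r.+1) * Lcoef (j - r).
  rewrite [RHS](eq_bigr (fun r : 'I_j.+1 => - ((\sum_(w <- ws) w ^+ r.+1) *
      (\prod_(w <- ws) (1 - w *: 'X))`_(j - r)))).
    rewrite sumrN -newton_power_sums -LcoefE mulr_natl Lcoef_recursion.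
    by rewrite big_add1 big_mkord.
  by move=> r _; rewrite mulNr LcoefE.
move=> r; have [m] := ubnP r; elim: m r => // m IHm r le_rm.
have := rec r; rewrite !big_ord_recr /= subnn Lcoef0 !mulr1.
rewrite (eq_bigr (fun i : 'I_r => (- \sum_(w <- ws) w ^+ i.+1) * Lcoef (r - i))).
  by move/addrI.
by move=> i _; rewrite IHm // (leq_trans (ltn_ord i)).
Qed.

End LFunction.

(** * Irreducible polynomials and Frobenius orbits *)

Section Frobenius.
Local Open Scope ring_scope.

Lemma pchar_nat_card (k : finFieldType) : [pchar k].-nat #|k|.
Proof.
have [p p_pr pchar_p] := finPcharP k.
have := pprimeChar_pgroup pchar_p; rewrite /pgroup cardsT => pk.
by apply: sub_in_pnat pk => l _ /eqP->.
Qed.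

Variables (k L : finFieldType) (j : {rmorphism k -> L}).
Let q := #|k|.

Lemma pchar_nat_card_ext : [pchar L].-nat q.
Proof.
by rewrite (eq_pnat _ (fmorph_pchar j)) pchar_nat_card.
Qed.

Lemma frobeniusD i (x y : L) : (x + y) ^+ (q ^ i) = x ^+ (q ^ i) + y ^+ (q ^ i).
Proof. by rewrite exprDn_pchar // pnatX pchar_nat_card_ext. Qed.

Lemma frobeniusB i (x y : L) : (x - y) ^+ (q ^ i) = x ^+ (q ^ i) - y ^+ (q ^ i).
Proof. by have := frobeniusD i (x - y) y; rewrite subrK => ->; rewrite addrK. Qed.

Lemma expf_card_iter (K : finFieldType) (x : K) i : x ^+ (#|K| ^ i) = x.
Proof. by elim: i => [|i IHi]; rewrite ?expr1 // expnSr exprM IHi expf_card. Qed.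

Lemma horner_frobenius i (h : {poly k}) (y : L) :
  (map_poly j h).[y] ^+ (q ^ i) = (map_poly j h).[y ^+ (q ^ i)].
Proof.
elim/poly_ind: h => [|h c IHh].
  by rewrite rmorph0 !horner0 expr0n gtn_eqF // expn_gt0 ltnW // finNzRing_gt1.
rewrite rmorphD rmorphM /= map_polyX map_polyC /= !hornerMXaddC frobeniusD exprMn IHh.
by rewrite -rmorphXn expf_card_iter.
Qed.

Lemma frobenius_cycle (x : L) d r :
  x ^+ (q ^ d) = x -> x ^+ (q ^ (r * d)) = x.
Proof. by move=> xd; elim: r => [|r IHr]; rewrite ?expr1 // mulSn expnD exprM xd. Qed.

Lemma frobenius_mod (x : L) d r :
  x ^+ (q ^ d) = x -> x ^+ (q ^ r) = x ^+ (q ^ (r %% d)).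
Proof. by move=> xd; rewrite {1}(divn_eq r d) expnD exprM frobenius_cycle. Qed.

Lemma frobenius_orbit_uniq (x : L) e : x ^+ (q ^ e) = x ->
  (forall o, (0 < o < e)%N -> x ^+ (q ^ o) != x) ->
  uniq [seq x ^+ (q ^ i) | i <- iota 0 e].
Proof.
move=> xe ne_x; rewrite map_inj_in_uniq ?iota_uniq // => a b.
rewrite !mem_iota /= !add0n; wlog le_ab : a b / (a <= b)%N => [wl|] la lb eq_ab.
  by case/orP: (leq_total a b) => ?; [|symmetry]; apply: wl.
have [lt_ab||//] := ltngtP a b; last by rewrite ltnNge le_ab.
have : x ^+ (q ^ (b - a)) != x.
  by apply: ne_x; rewrite subn_gt0 lt_ab (leq_ltn_trans (leq_subr _ _)).
have := congr1 (fun y => y ^+ (q ^ (e - a))) eq_ab.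
rewrite -!exprM -!expnD subnKC ?(ltnW la) // xe.
rewrite addnBA ?(ltnW la) // addnC -addnBA // expnD exprM xe.
by move=> <-; rewrite eqxx.
Qed.

(** A nonzero difference of size at most [e] cannot vanish at all the [e] distinct conjugates of
    [x]. *)
Lemma frobenius_orbit_eval_inj (x : L) e : x ^+ (q ^ e) = x ->
  (forall o, (0 < o < e)%N -> x ^+ (q ^ o) != x) ->
  injective (fun t : {poly_e k} => (map_poly j (val t)).[x]).
Proof.
move=> xe ne_x t t' eq_t; apply/val_inj/eqP; rewrite -subr_eq0; apply: contraT => nz.
have: (size [seq x ^+ (q ^ i) | i <- iota 0 e] < size (map_poly j (val t - val t')))%N.
  apply: max_poly_roots; [by rewrite map_poly_eq0| |exact: frobenius_orbit_uniq].
  apply/allP => _ /mapP[i _ ->]; apply/rootP.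
  rewrite -horner_frobenius rmorphB hornerD hornerN eq_t subrr.
  by rewrite expr0n gtn_eqF // expn_gt0 ltnW // finNzRing_gt1.
rewrite size_map_poly size_map size_iota ltnNge.
by rewrite (leq_trans (size_polyD _ _)) // size_polyN geq_max !size_npoly.
Qed.

(** The residue field of [P] has [q ^ pdeg P] elements, so the class of ['X] in it is a fixed point
    of the power [q ^ r]. *)
Lemma irr_dvdp_Xq (P : {poly k}) r : P \is monic -> irreducibleb P ->
  (pdeg P %| r)%N -> P %| 'X^(q ^ r) - 'X.
Proof.
move=> mP /irreducibleP irP /dvdnP[m ->].
pose mi : monic_irreducible_poly P := (irP, mP).
have eqX : in_qpoly P ('X^(q ^ (m * pdeg P)) - 'X) = 0.
  rewrite rmorphB rmorphXn /=.
  have := @expf_card_iter {poly %/ P with mi} (in_qpoly P 'X) m.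
  rewrite card_qfpoly -expnM mulnC => h.
  by apply/eqP; rewrite subr_eq0; apply/eqP.
have := congr1 val eqX; rewrite /= mk_monicE //.
by move/eqP; rewrite Pdiv.Idomain.dvdpE.
Qed.

Lemma irr_dvdp_root (P f : {poly k}) (x : L) : irreducibleb P ->
  root (map_poly j P) x -> root (map_poly j f) x -> P %| f.
Proof.
move=> /irreducibleP irP rP rf; apply: contraT; rewrite -irreducible_poly_coprime //.
move=> coPf; have := coprimep_root (p := map_poly j P) (q := map_poly j f) _ rP.
by rewrite coprimep_map => /(_ coPf)/eqP; rewrite (eqP rf).
Qed.

Lemma exists_irr_root (f : {poly k}) (x : L) : f != 0 -> root (map_poly j f) x ->
  exists P, [/\ P \is monic, irreducibleb P & root (map_poly j P) x].
Proof.
have [m] := ubnP (size f); elim: m f => // m IHm f le_fm nzf rf.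
have [sz1|szf] := leqP (size f) 1.
  have /size_poly1P[c nzc fc] : size f == 1%N by rewrite eqn_leq sz1 size_poly_gt0.
  by move: rf; rewrite fc map_polyC /= rootC fmorph_eq0 (negbTE nzc).
have [P [mP irP /dvdpP[g fg]]] := irr_monic_dvdp szf.
have nzg : g != 0 by apply: contraNneq nzf => g0; rewrite fg g0 mul0r.
move: rf; rewrite fg rmorphM /= rootM => /orP[rg|rP]; last by exists P.
apply: IHm rg => //; rewrite -ltnS (leq_trans _ le_fm) // ltnS fg.
rewrite size_Mmonic // (monic_pdeg mP) addnS /=.
by rewrite -[X in (X < _)%N]addn0 ltn_add2l irr_pdeg_gt0.
Qed.

Section Root.
Variables (P : {poly k}) (x : L).
Hypotheses (mP : P \is monic) (irP : irreducibleb P) (rP : root (map_poly j P) x).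
Let e := pdeg P.

Let e_gt0 : (0 < e)%N. Proof. exact: irr_pdeg_gt0. Qed.

Lemma irr_root_frobenius : x ^+ (q ^ e) = x.
Proof.
have /dvdpP[g] := irr_dvdp_Xq mP irP (dvdnn e).
move/(congr1 (fun f => (map_poly j f).[x])).
rewrite rmorphB rmorphM /= map_polyX rmorphXn /= map_polyX !hornerE.
by rewrite (eqP rP) mulr0 => /eqP; rewrite subr_eq0 => /eqP.
Qed.

(** Otherwise the power [q ^ o] would fix all the values at [x] of polynomials over [k]; there are
    at least [q ^ e] of them, more than ['X^(q ^ o) - 'X] has roots. *)
Lemma irr_root_frobenius_neq o : (0 < o < e)%N -> x ^+ (q ^ o) != x.
Proof.
case/andP=> o_gt0 lt_oe; apply/eqP => xo.
have q_gt1 : (1 < q)%N := finNzRing_gt1 k.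
pose h (t : {poly_e k}) := (map_poly j (val t)).[x].
have h_inj : injective h.
  move=> t u eq_tu; apply/val_inj/eqP; rewrite -subr_eq0; apply: contraT => nz.
  have dv : P %| val t - val u.
    apply: irr_dvdp_root rP _ => //; apply/rootP.
    by rewrite rmorphB hornerD hornerN -/(h t) -/(h u) eq_tu subrr.
  have := dvdp_leq nz dv; rewrite leqNgt (monic_pdeg mP) ltnS.
  by rewrite (leq_trans (size_polyD _ _)) // size_polyN geq_max !size_npoly.
have szX : size ('X^(q ^ o) - 'X : {poly L}) = (q ^ o).+1.
  by rewrite size_polyDl ?size_polyXn // size_polyN size_polyX ltnS
    (leq_trans q_gt1) // -[X in (X <= _)%N]expn1 leq_exp2l.
have : (#|codom h| < size ('X^(q ^ o) - 'X : {poly L})%R)%N.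
  rewrite cardE; apply: max_poly_roots; last exact: enum_uniq.
    by rewrite -size_poly_eq0 szX.
  apply/allP => y; rewrite mem_enum => /codomP[t ->].
  by rewrite /root !hornerE /h horner_frobenius xo subrr.
by rewrite szX ltnS card_codom // card_npoly leq_exp2l // leqNgt lt_oe.
Qed.

Lemma irr_root_prod :
  map_poly j P = \prod_(i < e) ('X - (x ^+ (q ^ i))%:P).
Proof.
pose rs := [seq x ^+ (q ^ i) | i <- iota 0 e].
have -> : \prod_(i < e) ('X - (x ^+ (q ^ i))%:P) = \prod_(z <- rs) ('X - z%:P).
  by rewrite big_map -(big_mkord xpredT (fun i => 'X - (x ^+ (q ^ i))%:P)) /index_iota subn0.
have := @all_roots_prod_XsubC _ (map_poly j P) rs.
rewrite (monicP (monic_map j mP)) scale1r; apply.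
- by rewrite size_map_poly (monic_pdeg mP) size_map size_iota.
- apply/allP => _ /mapP[i _ ->]; apply/rootP; rewrite -horner_frobenius (eqP rP).
  by rewrite expr0n gtn_eqF // expn_gt0 ltnW // finNzRing_gt1.
rewrite uniq_rootsE; apply: frobenius_orbit_uniq; first exact: irr_root_frobenius.
exact: irr_root_frobenius_neq.
Qed.

Lemma irr_root_dvdn r : x ^+ (q ^ r) = x -> (e %| r)%N.
Proof.
move=> xr; rewrite /dvdn; apply: contraT => nz.
have := @irr_root_frobenius_neq (r %% e)%N; rewrite lt0n nz ltn_pmod // => /(_ isT).
by rewrite -frobenius_mod ?xr ?eqxx // irr_root_frobenius.
Qed.

End Root.

Lemma card_irr_roots (P : {poly k}) r : P \is monic -> irreducibleb P ->
  #|L| = (q ^ r)%N -> (pdeg P %| r)%N -> #|[set x | root (map_poly j P) x]| = pdeg P.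
Proof.
move=> mP irP cardL dv_r; have := irr_dvdp_Xq mP irP dv_r.
rewrite -(dvdp_map j) rmorphB /= map_polyX rmorphXn /= map_polyX -cardL.
rewrite finField_genPoly -big_enum /= => /dvdp_prod_XsubC[m].
set rs := mask m _; rewrite eqp_monic ?monic_map ?monic_prod_XsubC // => /eqP Prs.
have u_rs : uniq rs by rewrite mask_uniq ?enum_uniq.
rewrite /pdeg -(size_map_poly j) Prs size_prod_XsubC /= cardE.
apply/perm_size/uniq_perm; rewrite ?enum_uniq // => x.
by rewrite mem_enum inE -root_prod_XsubC.
Qed.

(** The elements of [L] are grouped by their minimal polynomials over [k]: these are the [P] whose
    degree divides [r], and each has exactly [pdeg P] roots in [L], which accounts for the weight in
    [Lpower]. *)
Lemma Lpower_sum_ext (R : comNzRingType) (chi : {poly k} -> R) (Phi : L -> R) r :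
  (0 < r)%N -> #|L| = (q ^ r)%N ->
  (forall P x, P \is monic -> irreducibleb P -> root (map_poly j P) x ->
     (pdeg P %| r)%N -> chi P ^+ (r %/ pdeg P) = Phi x) ->
  Lpower chi r = \sum_x Phi x.
Proof.
move=> r_gt0 cardL PhiE.
have q_gt1 : (1 < q)%N := finNzRing_gt1 k.
transitivity (\sum_x \sum_(P <- irr_monics k r | (pdeg P %| r)%N && root (map_poly j P) x) Phi x);
  last first.
  apply: eq_bigr => x _.
  have [P [mP irP rP]] : exists P, [/\ P \is monic, irreducibleb P & root (map_poly j P) x].
    apply: (@exists_irr_root ('X^(q ^ r) - 'X)).
      rewrite -size_poly_eq0 size_polyDl ?size_polyXn // size_polyN size_polyX ltnS.
      by rewrite (leq_trans q_gt1) // -[X in (X <= _)%N]expn1 leq_exp2l.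
    rewrite rmorphB /= map_polyX rmorphXn /= map_polyX /root !hornerE -cardL.
    by rewrite expf_card subrr.
  have dvP : (pdeg P %| r)%N.
    by apply: (irr_root_dvdn mP irP rP); rewrite -cardL expf_card.
  rewrite -big_filter (perm_big [:: P]) ?big_seq1 //.
  apply: uniq_perm => // [|Q]; first exact/filter_uniq/irr_monics_uniq.
  rewrite mem_filter mem_irr_monics inE; apply/idP/eqP => [|->]; last first.
    by rewrite dvP rP mP irP dvdn_leq.
  case/andP=> /andP[_ rQ] /and3P[mQ irQ _].
  apply/eqP; rewrite -eqp_monic // /eqp.
  by rewrite (irr_dvdp_root irQ rQ rP) (irr_dvdp_root irP rP rQ).
rewrite (exchange_big_dep (fun P => (pdeg P %| r)%N)) /=; last by move=> ? ? _ /andP[].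
rewrite /Lpower big_seq_cond [RHS]big_seq_cond; apply: eq_bigr => P.
rewrite mem_irr_monics => /andP[/and3P[mP irP _] dvP].
rewrite -[X in _ *+ X](card_irr_roots mP irP cardL dvP) -sumr_const; apply: eq_big => x.
  by rewrite inE dvP.
by rewrite inE => rP; apply: PhiE.
Qed.

End Frobenius.

(** * Subfields and extensions of finite fields *)

Section SubfieldType.
Local Open Scope ring_scope.
Variables (F : finFieldType) (S : {set F}) (Sf : divring_closed (R := F) S).

(** The closure proof is an argument so that the instances keyed on this predicate can recover
    it. *)
Definition subfield_pred (Sf' : divring_closed (R := F) S) : {pred F} := mem S.
HB.instance Definition _ := GRing.isDivringClosed.Build F (subfield_pred Sf) Sf.

Definition subfield_type := {x : F | x \in subfield_pred Sf}.
HB.instance Definition _ := [isSub of subfield_type for sval].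
HB.instance Definition _ := [Finite of subfield_type by <:].
HB.instance Definition _ := [SubChoice_isSubIntegralDomain of subfield_type by <:].
HB.instance Definition _ := [SubIntegralDomain_isSubField of subfield_type by <:].

Lemma card_subfield_type : #|{: subfield_type}| = #|S|.
Proof. by rewrite card_sub; apply: eq_card. Qed.

Lemma subfield_type_lift (K : finFieldType) (j : {rmorphism K -> F}) :
  (forall x, j x \in S) ->
  exists j' : {rmorphism K -> subfield_type}, forall x, val (j' x) = j x.
Proof.
move=> jS; pose f x : subfield_type := Sub (j x) (jS x).
have fB : zmod_morphism f by move=> x y; apply: val_inj; rewrite /= rmorphB.
have fM : monoid_morphism f.
  by split=> [|x y]; apply: val_inj; rewrite /= ?rmorph1 ?rmorphM.
pose fA := GRing.isZmodMorphism.Build K subfield_type f fB.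
pose fR := GRing.isMonoidMorphism.Build K subfield_type f fM.
pose j' : {rmorphism K -> subfield_type} := HB.pack f fA fR.
by exists j'.
Qed.

End SubfieldType.

Section Extensions.
Local Open Scope ring_scope.

Lemma fixed_subfield (F : finFieldType) Q : [pchar F].-nat Q ->
  divring_closed (R := F) [set x : F | x ^+ Q == x].
Proof.
move=> pQ; split=> [|x y|x y]; rewrite !inE ?expr1n //.
  move=> /eqP xQ /eqP yQ.
  have := exprDn_pchar (x - y) y pQ; rewrite subrK xQ yQ => e.
  by rewrite [X in _ == X - _]e addrK.
by move=> /eqP xQ /eqP yQ; rewrite exprMn exprVn xQ yQ.
Qed.

(** The field is the set of roots of ['X^Q - 'X] in a splitting field; there are [Q] of them because
    the derivative is -1. *)
Lemma finField_extension (F : finFieldType) t : (0 < t)%N ->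
  exists (L : finFieldType) (j : {rmorphism F -> L}), #|L| = (#|F| ^ t)%N.
Proof.
move=> t_gt0; pose Q := (#|F| ^ t)%N.
have F_gt1 : (1 < #|F|)%N := finNzRing_gt1 F.
have Q_gt1 : (1 < Q)%N by rewrite (leq_trans F_gt1) // -[X in (X <= _)%N]expn1 leq_exp2l.
have szX (R : fieldType) : size ('X^Q - 'X : {poly R}) = Q.+1.
  by rewrite size_polyDl ?size_polyXn // size_polyN size_polyX ltnS.
have /FinSplittingFieldFor[L0 [zs Dq _]] : 'X^Q - 'X != 0 :> {poly F}.
  by rewrite -size_poly_eq0 szX.
rewrite rmorphB rmorphXn /= map_polyX in Dq.
pose L : finFieldType := FinFieldExtType L0.
pose j0 : {rmorphism F -> L} := in_alg L0.
have pQ : [pchar L].-nat Q by rewrite pnatX (pchar_nat_card_ext j0).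
have Zf := fixed_subfield pQ.
have [j _] : exists j' : {rmorphism F -> subfield_type Zf}, forall x, val (j' x) = j0 x.
  by apply: subfield_type_lift => x; rewrite inE -rmorphXn expf_card_iter.
exists (subfield_type Zf), j; rewrite card_subfield_type.
have u_zs : uniq zs.
  rewrite -separable_prod_XsubC -(eqp_separable Dq) unlock.
  rewrite derivB derivX derivXn -mulr_natr.
  have -> : Q%:R = 0 :> {poly L0}.
    have pdQ : pdiv Q \in [pchar L] by apply: (pnatPpi pQ); rewrite pi_pdiv.
    have Q0 : Q%:R = 0 :> L by apply/eqP; rewrite -(dvdn_pcharf pdQ) pdiv_dvd.
    by rewrite -polyC_natr; congr polyC; exact: Q0.
  by rewrite mulr0 sub0r -[X in coprimep _ X]scaleN1r coprimepZr ?oppr_eq0 ?oner_eq0 // coprimep1.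
apply: succn_inj; rewrite -(szX L0) (eqp_size Dq) size_prod_XsubC; congr _.+1.
rewrite cardE; apply/perm_size/uniq_perm; rewrite ?enum_uniq // => x.
rewrite mem_enum inE -root_prod_XsubC -(eqp_root Dq) /root !hornerE subr_eq0.
by [].
Qed.
End Extensions.

(** * Characters of finite fields *)

Section Characters.
Local Open Scope ring_scope.

Definition stepanov_const (M l : nat) := (1 + l * (3 * M + 3) + l * (2 * l * M.+1))%N.

(* The substitution [u = 1 / (x - v)] moves the simple zero [v] to infinity, which makes the degree
   of the polynomial prime to [l]. *)
Lemma stepanov_bound_twist (F : finFieldType) (s l E n : nat) (v z : F)
    (c : 'I_n -> F) (m : 'I_n -> nat) (M := ((\sum_i m i).+1)%N)
    (f := fun x => (v - x) * \prod_i (c i - x) ^+ m i) :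
  #|F| = (s ^ 2)%N -> [pchar F].-nat s -> (0 < l)%N -> (s ^ 2 = (l * E).+1)%N ->
  (forall i, c i != v) -> z != 0 ->
  (l * #|[set x | f x ^+ E == z]| <= s ^ 2 + s * stepanov_const (M * l).-1 l)%N.
Proof.
move=> cardF s_char l_gt0 lE ne_c nz_z.
have [->|[x0]] := set_0Vmem [set x | f x ^+ E == z]; first by rewrite cards0 muln0.
rewrite inE => /eqP fx0.
have E_gt0 : (0 < E)%N.
  case: (posnP E) lE => // ->; rewrite muln0 -cardF => cF1.
  by have := finNzRing_gt1 F; rewrite cF1.
have nz_fx x : f x ^+ E = z -> f x != 0.
  by move=> fx; apply: contraNneq nz_z => fx_0; rewrite -fx fx_0 expr0n gtn_eqF.
pose lin i : {poly F} := (c i - v) *: 'X - 1.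
have sz_lin i : size (lin i) = 2%N.
  rewrite /lin size_polyDl size_scale ?subr_eq0 // ?size_polyX //.
  by rewrite size_polyN size_poly1.
(* At [u = 1 / (x - v)] the product of the [lin i ^+ m i] is [- f x * u ^ M]. The power of ['X]
   completes [u ^ M] to an [l]-th power, which the exponent [E] sends to 1, and makes the degree
   [M * l - 1], prime to [l]. The factor with [x0] moves the class of [z] to that of 1. *)
pose f1 : {poly F} := (- (f x0)^-1) *: ('X^(M * l.-1) * \prod_i lin i ^+ m i).
have nz_c : - (f x0)^-1 != 0 by rewrite oppr_eq0 invr_eq0 nz_fx.
have nz_lin i : lin i != 0 by rewrite -size_poly_eq0 sz_lin.
have nz_prod : \prod_i lin i ^+ m i != 0.
  by apply/prodf_neq0 => i _; rewrite expf_neq0.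
have size_f1 : size f1 = ((M * l).-1).+1.
  rewrite size_scale // mulrC size_mulXn // size_prod => [|i _]; last by rewrite expf_neq0.
  have -> : (\sum_(i < n) size (lin i ^+ m i) = \sum_(i < n) m i + n)%N.
    rewrite -[X in (_ + X)%N]card_ord -sum1_card -big_split /=; apply: eq_bigr => i _.
    have e : (size (lin i ^+ m i)).-1 = m i by rewrite size_exp sz_lin mul1n.
    by rewrite addn1 -[in RHS]e prednK // size_poly_gt0 expf_neq0.
  rewrite card_ord -addSn addnK -/M prednK ?muln_gt0 ?l_gt0 //.
  by rewrite -[in RHS](prednK l_gt0) mulnS addnC.
have co : coprime (M * l).-1 l.
  apply: (@coprime_dvdr _ (M * l)); first exact: dvdn_mull.
  by rewrite coprime_sym coprimenP // muln_gt0.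
apply: leq_trans (stepanov_bound cardF s_char l_gt0 lE size_f1 co).
rewrite leq_mul2l; apply/orP; right.
have inj : {in [set x | f x ^+ E == z] &, injective (fun x => (x - v)^-1)}.
  by move=> x y _ _ /invr_inj/addIr.
rewrite -(card_in_imset inj); apply/subset_leq_card/subsetP => _ /imsetP[x + ->].
rewrite !inE => /eqP fx; set u := (x - v)^-1.
have ne_xv : x - v != 0.
  by rewrite subr_eq0; apply: contraNneq (nz_fx _ fx) => ->; rewrite /f subrr mul0r.
have f1u : f1.[u] = (f x0)^-1 * f x * (u ^+ M) ^+ l.
  have ux : (v - x) * u = -1 by rewrite -opprB mulNr mulfV.
  have linu i : (lin i).[u] = (c i - x) * u.
    rewrite /lin !hornerE -[1](mulfV ne_xv) -mulrBl; congr (_ * _); ring.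
  rewrite /f1 hornerZ hornerM horner_prod hornerXn.
  under eq_bigr => i _ do rewrite horner_exp linu exprMn.
  rewrite big_split /= -exprM -[in RHS](prednK l_gt0) mulnS exprD /M.
  rewrite [u ^+ (\sum_i m i).+1]exprS.
  have -> : \prod_(i < n) u ^+ m i = u ^+ (\sum_i m i) by rewrite -expr_sum.
  move: (f x0)^-1 => c0; rewrite /f; set A := \prod_i _; set B := u ^+ _; set C := u ^+ _.
  transitivity ((c0 * A * B * C) * ((v - x) * u)); last by ring.
  by rewrite ux; ring.
rewrite f1u exprMn exprMn exprVn fx fx0 mulVf // mul1r -!exprM.
have ulE : u ^+ (l * E) = 1.
  have nz_u : u != 0 by rewrite invr_eq0.
  by apply: (mulfI nz_u); rewrite mulr1 -exprS -lE -cardF expf_card.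
by rewrite -mulnA mulnC exprM ulE expr1n.
Qed.

Lemma finField_prim_root (F : finFieldType) : exists g : F, (#|F|.-1).-primitive_root g.
Proof.
have F_gt1 : (1 < #|F|)%N := finNzRing_gt1 F.
have /hasP[g _ prim_g] : has (#|F|.-1).-primitive_root [seq x <- enum F | x != 0].
  apply: has_prim_root.
  - by rewrite -subn1 subn_gt0.
  - apply/allP => x; rewrite mem_filter => /andP[nz_x _]; rewrite unity_rootE.
    apply/eqP/(mulfI nz_x); rewrite mulr1 -exprS prednK ?expf_card //.
    exact: ltnW.
  - by rewrite filter_uniq ?enum_uniq.
  rewrite size_filter -sum1_count big_enum_cond sum1_card -(cardC1 (0 : F)).
  by apply: subset_leq_card; apply/subsetP.
by exists g.
Qed.

Section Character.
Variables (F : finFieldType) (l E : nat) (w : F) (zeta : algC).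
Hypotheses (l_gt1 : (1 < l)%N) (lE : #|F| = (l * E).+1).
Hypotheses (prim_w : l.-primitive_root w) (prim_zeta : l.-primitive_root zeta).

Let l_gt0 : (0 < l)%N. Proof. exact: ltnW. Qed.

Let E_gt0 : (0 < E)%N.
Proof.
case: (posnP E) lE => // ->; rewrite muln0 => cF1.
by have := finNzRing_gt1 F; rewrite cF1.
Qed.

(** For [x != 0], [x ^+ E] is an [l]-th root of unity, that is a power of [w], and is carried to the
    same power of [zeta]; the default value 0 is taken at 0 only. *)
Definition character (x : F) : algC :=
  if [pick i : 'I_l | x ^+ E == w ^+ i] is Some i then zeta ^+ i else 0.

Lemma characterP x i : x ^+ E = w ^+ i -> character x = zeta ^+ i.
Proof.
move=> xi; rewrite /character; case: pickP => [i' /eqP|no].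
  rewrite xi => /eqP; rewrite (eq_prim_root_expr prim_w) => eq_i.
  by apply/eqP; rewrite (eq_prim_root_expr prim_zeta) eq_sym.
have /eqP[] := negbT (no (Ordinal (ltn_pmod i l_gt0))).
by rewrite /= xi prim_expr_mod.
Qed.

Let w_neq0 i : w ^+ i != 0.
Proof. by rewrite expf_neq0 // (prim_root_eq0 prim_w) gtn_eqF. Qed.

Lemma character0 : character 0 = 0.
Proof.
rewrite /character; case: pickP => // i /eqP/esym/eqP.
by rewrite expr0n gtn_eqF // (negbTE (w_neq0 i)).
Qed.

Lemma character1 : character 1 = 1.
Proof. by rewrite (@characterP _ 0) ?expr1n. Qed.

Lemma character_exp x : x != 0 -> exists i, x ^+ E = w ^+ i.
Proof.
move=> nz_x; have /(prim_rootP prim_w)[i ->] : (x ^+ E) ^+ l = 1; last by exists i.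
by apply: (mulfI nz_x); rewrite mulr1 -exprM mulnC -exprS -lE expf_card.
Qed.

Lemma characterM : {morph character : x y / x * y}.
Proof.
move=> x y; have [->|/character_exp[i xi]] := eqVneq x 0.
  by rewrite mul0r character0 mul0r.
have [->|/character_exp[i' yi]] := eqVneq y 0; first by rewrite mulr0 character0 mulr0.
by rewrite (characterP xi) (characterP yi) -exprD; apply: characterP; rewrite exprMn xi yi exprD.
Qed.

Lemma sum_character : \sum_x character x = 0.
Proof.
have [g wg] : exists g : F, g ^+ E = w.
  have [g0 prim_g0] := finField_prim_root F.
  have prim_g : l.-primitive_root (g0 ^+ E).
    have := dvdn_prim_root prim_g0 (_ : (l %| #|F|.-1)%N); rewrite lE /= mulKn //; apply.
    exact: dvdn_mulr.
  have [i wi] := prim_rootP prim_g (prim_expr_order prim_w).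
  by exists (g0 ^+ i); rewrite wi -!exprM mulnC.
have nz_g : g != 0.
  by apply: contraTneq (w_neq0 1) => g0; rewrite -wg g0 expr1 expr0n gtn_eqF ?eqxx.
have chig : character g = zeta by rewrite (@characterP _ 1) ?expr1.
have : \sum_x character x = zeta * \sum_x character x.
  rewrite {1}(reindex_inj (mulfI nz_g)) mulr_sumr; apply: eq_bigr => x _.
  by rewrite characterM chig.
move/eqP; rewrite -subr_eq0 -{1}[X in X - _]mul1r -mulrBl mulf_eq0 subr_eq0.
have /negbTE-> /= : 1 != zeta.
  by rewrite eq_sym -(expr1 zeta) -(prim_order_dvd prim_zeta 1) dvdn1 gtn_eqF.
by move/eqP.
Qed.

(** Since the powers of [zeta] sum to 0, each class size may be diminished by the common upper bound
    [u] at no cost. The deficits are then nonnegative, so the norm of the sum is at most their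
    total, and the sizes add up to at least [#|F| - n0]. *)
Lemma character_sum_bound (f : F -> F) (b n0 : nat) :
  (forall i, (l * #|[set x | f x ^+ E == w ^+ i]| <= #|F| + b)%N) ->
  (#|[set x | f x == 0%R]| <= n0)%N ->
  `|\sum_x character (f x)| <= (b + n0)%:R.
Proof.
move=> class_le zero_le.
pose N i := #|[set x | f x ^+ E == w ^+ i]|.
have sum_zeta : \sum_(i < l) zeta ^+ i = 0.
  have nz : zeta - 1 != 0.
    by rewrite subr_eq0 -(expr1 zeta) -(prim_order_dvd prim_zeta 1) dvdn1 gtn_eqF.
  apply: (mulfI nz); rewrite mulr0 -subrX1 prim_expr_order // subrr //.
have part (R : nmodType) (h : F -> R) : \sum_(x | f x != 0) h x =
    \sum_(i < l) \sum_(x in [set x | f x ^+ E == w ^+ i]) h x.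
  rewrite (exchange_big_dep (fun x => f x != 0)) /=; last first.
    move=> i x _; rewrite inE => /eqP fx; apply: contraNneq (w_neq0 i) => fx0.
    by rewrite -fx fx0 expr0n gtn_eqF.
  apply: eq_bigr => x /character_exp[i xi].
  rewrite (big_pred1 (Ordinal (ltn_pmod i l_gt0))) // => i' /=.
  rewrite inE xi (eq_prim_root_expr prim_w) -val_eqE /= (modn_small (ltn_ord i')).
  by rewrite eq_sym.
have sumN : (\sum_(i < l) N i + n0 >= #|F|)%N.
  rewrite -sum1_card (bigID (fun x => f x == 0)) /= addnC leq_add //; last first.
    by rewrite sum1dep_card.
  rewrite (part nat (fun=> 1%N)) leq_sum // => i _.
  by rewrite /N sum1_card.
pose u : algC := (#|F| + b)%:R / l%:R.
have -> : \sum_x character (f x) = \sum_(i < l) ((N i)%:R - u) * zeta ^+ i.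
  rewrite (bigID (fun x => f x != 0)) /= [X in _ + X]big1 ?addr0; last first.
    by move=> x; rewrite negbK => /eqP->; exact: character0.
  rewrite part; under [RHS]eq_bigr => i _ do rewrite mulrBl.
  rewrite sumrB -mulr_sumr sum_zeta mulr0 subr0; apply: eq_bigr => i _.
  rewrite (eq_bigr (fun=> zeta ^+ i)); last by move=> x; rewrite inE => /eqP/characterP.
  by rewrite sumr_const mulr_natl.
apply: le_trans (ler_norm_sum _ _ _) _.
have l_gt0R : 0 < l%:R :> algC by rewrite ltr0n.
have le_u i : (N i)%:R <= u :> algC.
  by rewrite /u ler_pdivlMr // -natrM ler_nat mulnC class_le.
rewrite (eq_bigr (fun i : 'I_l => u - (N i)%:R)); last first.
  have norm1 : `|zeta| = 1.
    by apply/eqP; rewrite -(@pexpr_eq1 _ _ l) // -normrX prim_expr_order // normr1.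
  move=> i _; rewrite normrM normrX norm1 expr1n mulr1 distrC ger0_norm //.
  by rewrite subr_ge0.
rewrite sumrB sumr_const card_ord -[u *+ l]mulr_natr /u mulfVK ?gt_eqF // -natr_sum.
rewrite lerBlDr -natrD ler_nat addnC -addnA leq_add2l addnC.
exact: sumN.
Qed.
End Character.
End Characters.

(** * The Weil bound for shifts of a generator *)

Section WeilBound.
Local Open Scope ring_scope.

Lemma prod_blocks (R : comPzRingType) (G : nat -> R) m e :
  \prod_(i < m * e) G i = \prod_(a < m) \prod_(i < e) G (a * e + i)%N.
Proof.
elim: m => [|m IHm]; first by rewrite !big_ord0.
by rewrite big_ord_recr /= -IHm mulSn addnC big_split_ord.
Qed.

Lemma prod_periodic (R : comPzRingType) (G : nat -> R) m e :
  (forall i, G (e + i)%N = G i) -> \prod_(i < m * e) G i = (\prod_(i < e) G i) ^+ m.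
Proof.
move=> GE; rewrite prod_blocks.
have GaE a i : G (a * e + i)%N = G i.
  by elim: a => [|a IHa]; rewrite ?add0n // mulSn -addnA GE.
under eq_bigr => a _ do under eq_bigr => i _ do rewrite GaE.
by rewrite prodr_const card_ord.
Qed.

Variables (k F : finFieldType) (j : {rmorphism k -> F}) (n l E : nat) (v : F).
Let q := #|k|.
Hypotheses (n_gt0 : (0 < n)%N) (cardF : #|F| = (q ^ n)%N).
Hypothesis (v_gen : forall i, (0 < i < n)%N -> v ^+ (q ^ i) != v).
Hypotheses (l_gt1 : (1 < l)%N) (lE : #|F| = (l * E).+1).

Let q_gt1 : (1 < q)%N. Proof. exact: finNzRing_gt1. Qed.
Let l_gt0 : (0 < l)%N. Proof. exact: ltnW. Qed.
Let vqn : v ^+ (q ^ n) = v. Proof. by rewrite -cardF expf_card. Qed.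
Let E_gt0 : (0 < E)%N.
Proof.
case: (posnP E) lE => // ->; rewrite muln0 => cF1.
by have := finNzRing_gt1 F; rewrite cF1.
Qed.

Lemma generator_eval_onto (u : F) :
  exists2 h : {poly k}, (size h <= n)%N & (map_poly j h).[v] = u.
Proof.
pose ev (t : {poly_n k}) := (map_poly j (val t)).[v].
have ev_inj : injective ev := frobenius_orbit_eval_inj vqn v_gen.
have /codomP[t ->] : u \in codom ev.
  by apply: inj_card_onto => //; rewrite card_npoly cardF.
by exists (val t); rewrite ?size_npoly.
Qed.

Section Character.
Variables (w : F) (zeta : algC).
Hypotheses (prim_w : l.-primitive_root w) (prim_zeta : l.-primitive_root zeta).

Let chi0 := character l E w zeta.
(** A Dirichlet character modulo the minimal polynomial of [v]. *)
Definition poly_character (f : {poly k}) := chi0 (map_poly j f).[v].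
Let chi := poly_character.

Lemma poly_character1 : chi 1 = 1.
Proof. by rewrite /chi /poly_character rmorph1 hornerC /chi0 character1. Qed.

Lemma poly_characterM : {morph chi : f g / f * g}.
Proof. by move=> f g; rewrite /chi /poly_character rmorphM hornerM /chi0 characterM. Qed.

(** Adding a polynomial of degree below [n] permutes the monic polynomials of degree [i] and shifts
    their values at [v] by an arbitrary [u]. Averaging over [u] leaves complete sums of a nontrivial
    character. *)
Lemma Lcoef_eq0 i : (n <= i)%N -> Lcoef chi i = 0.
Proof.
move=> le_ni.
have shift u : \sum_(f <- monics k i) chi0 ((map_poly j f).[v] + u) = Lcoef chi i.
  have [h szh <-] := generator_eval_onto u.
  have szh' : (size h < i.+1)%N by rewrite ltnS (leq_trans szh).
  have shiftP (g : {poly k}) : size g = i.+1 ->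
      (size (g + h)%R == i.+1) && ((g + h \is monic) == (g \is monic)).
    by move=> szg; rewrite size_polyDl ?szg // eqxx !monicE lead_coefDl ?szg /=.
  rewrite /Lcoef [RHS](perm_big [seq f + h | f <- monics k i]) /=.
    rewrite big_map; apply: eq_bigr => f _.
    by rewrite /chi /poly_character rmorphD hornerD.
  rewrite perm_sym; apply: uniq_perm; rewrite ?monics_uniq //.
    by rewrite map_inj_uniq ?monics_uniq // => f g /addIr.
  move=> f; rewrite mem_monics; apply/mapP/andP => [[g]|[mf /eqP szf]].
    rewrite mem_monics => /andP[mg /eqP szg] ->.
    by have /andP[-> /eqP->] := shiftP _ szg.
  exists (f - h); last by rewrite subrK.
  rewrite mem_monics; have szN : size (f - h) = i.+1.
    by rewrite size_polyDl ?size_polyN szf.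
  by have /andP[_ /eqP<-] := shiftP _ szN; rewrite subrK mf szN eqxx.
have : \sum_(u : F) Lcoef chi i = 0.
  under eq_bigr => u _ do rewrite -(shift u).
  rewrite exchange_big big1 // => f _ /=.
  transitivity (\sum_u chi0 u); last exact: sum_character.
  by rewrite [RHS](reindex_inj (addrI (map_poly j f).[v])).
rewrite sumr_const => /eqP; rewrite -mulr_natr mulf_eq0 pnatr_eq0 => /orP[/eqP//|].
by rewrite cardF expn_eq0 gtn_eqF // ltnW.
Qed.

Let M := (\sum_(i < n.-1) q ^ i.+1).+1.
Definition weil_const := (stepanov_const (M * l).-1 l + n)%N.

(** For a root [x] of [P], the power of [P.[v]] in [Lpower] is the product of [v - x ^ (q ^ i)] over
    [i < r]. The block [i < n] is [f x], where [f] has degree [M] for every [t], and the other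
    blocks are its conjugates over [F]. *)
Lemma Lpower_bound t : (0 < t)%N ->
  `|Lpower chi (2 * n * t)| <= weil_const%:R * (q ^ n)%:R ^+ t.
Proof.
move=> t_gt0; pose r := (2 * t * n)%N; have -> : (2 * n * t = r)%N by rewrite /r mulnAC.
have t2_gt0 : (0 < 2 * t)%N by rewrite muln_gt0.
have [L [h cardL']] := finField_extension F t2_gt0.
(* The power [T] is the norm from [L] to [F], so [chi0] of the norm is the character of [L] with
   exponent [E * T]. *)
pose s := (q ^ (n * t))%N; pose T := (\sum_(a < 2 * t) (q ^ n) ^ a)%N.
pose jj : {rmorphism k -> L} := h \o j.
have cardL : #|L| = (s ^ 2)%N by rewrite cardL' cardF -!expnM; congr (_ ^ _)%N; lia.
have cardLr : #|L| = (q ^ r)%N by rewrite cardL' cardF -!expnM /r; congr (_ ^ _)%N; lia.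
have lET : (s ^ 2 = (l * (E * T)).+1)%N.
  rewrite -cardL cardL' -[LHS]prednK ?expn_gt0 ?lE //; congr _.+1.
  by rewrite predn_exp mulnA /T -cardF lE.
have lETL : #|L| = (l * (E * T)).+1 by rewrite cardL.
have ET_gt0 : (0 < E * T)%N.
  case: (posnP (E * T)) lETL => // ->; rewrite muln0 => cF1.
  by have := finNzRing_gt1 L; rewrite cF1.
have r_gt0 : (0 < r)%N by rewrite !muln_gt0 t_gt0.
have prim_hw : l.-primitive_root (h w) by rewrite fmorph_primitive_root.
(* Chosen so that [c i ^ (q ^ i.+1) = h v], whence [h v - x ^ (q ^ i.+1) = (c i - x) ^ (q ^ i.+1)].
   As [c i] differs from [h v], the latter is a simple zero of [f]. *)
pose c (i : 'I_n.-1) : L := h v ^+ (q ^ (n.-1 - i)).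
have ne_c i : c i != h v.
  rewrite /c -rmorphXn (inj_eq (fmorph_inj h)) v_gen //.
  by rewrite subn_gt0 ltn_ord /= (leq_ltn_trans (leq_subr _ _)) // prednK.
pose f x := (h v - x) * \prod_i (c i - x) ^+ (q ^ i.+1).
have fE x : \prod_(i < r) (h v - x ^+ (q ^ i)) = f x ^+ T.
  rewrite /T expr_sum /r (prod_blocks (fun i => h v - x ^+ (q ^ i))).
  apply: eq_bigr => a _; rewrite /f.
  have recl (G : nat -> L) : \prod_(i < n) G i = G 0%N * \prod_(i < n.-1) G i.+1.
    by rewrite -[in LHS](prednK n_gt0) big_ord_recl.
  have hvn : h v ^+ (q ^ n) = h v by rewrite -rmorphXn vqn.
  rewrite (recl (fun i => h v - x ^+ (q ^ (a * n + i)))) addn0 exprMn -expnM [(n * a)%N]mulnC.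
  rewrite (frobeniusB jj) frobenius_cycle //; congr (_ * _).
  rewrite -prodrXl; apply: eq_bigr => i _; rewrite -exprM -expnD (frobeniusB jj).
  rewrite [(i.+1 + _)%N]addnC /c -exprM -expnD.
  have -> : (n.-1 - i + (a * n + i.+1) = a.+1 * n)%N.
    by have := ltn_ord i; lia.
  by rewrite frobenius_cycle.
have -> : Lpower chi r = \sum_x character l (E * T) (h w) zeta (f x).
  apply: (@Lpower_sum_ext _ _ jj) => // P x mP irP rP dvP.
  set m := (r %/ pdeg P)%N; pose y := (map_poly j P).[v] ^+ m.
  have chiX z i : chi0 (z ^+ i) = chi0 z ^+ i.
    elim: i => [|i IHi]; first by rewrite /chi0 character1.
    by rewrite !exprS /chi0 characterM // -/chi0 IHi.
  have -> : chi P ^+ m = chi0 y by rewrite /y chiX.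
  have hy : h y = f x ^+ T.
    rewrite -fE -(divnK dvP) -/m (prod_periodic (G := fun i => h v - x ^+ (q ^ i))).
      rewrite /y rmorphXn /= -horner_map -map_poly_comp; congr (_ ^+ _).
      rewrite (irr_root_prod (j := jj) mP irP rP) horner_prod; apply: eq_bigr => i _.
      by rewrite hornerXsubC.
    by move=> i; rewrite expnD exprM (irr_root_frobenius (j := jj) mP irP rP).
  have [y0|nz_y] := eqVneq y 0.
    have -> : f x = 0.
      by apply/eqP; move/eqP: hy; rewrite y0 rmorph0 eq_sym expf_eq0 => /andP[].
    by rewrite y0 /chi0 !character0.
  have [i yi] := character_exp lE prim_w nz_y.
  rewrite /chi0 (characterP l_gt1 prim_w prim_zeta yi).
  apply/esym/characterP => //.
  by rewrite mulnC exprM -hy -rmorphXn yi rmorphXn.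
apply: le_trans (character_sum_bound (b := s * stepanov_const (M * l).-1 l) (n0 := n)
    _ _ _ _ _ _) _ => //.
- move=> i; rewrite cardL; apply: stepanov_bound_twist => //.
    by rewrite pnatX (pchar_nat_card_ext jj).
  by rewrite expf_neq0 // (prim_root_eq0 prim_hw) gtn_eqF.
- have : [set x | f x == 0] \subset (h v) |: [set c i | i : 'I_n.-1].
    apply/subsetP => x; rewrite !inE /f mulf_eq0 subr_eq0 eq_sym.
    case/orP=> [->//|/prodf_eq0[i _]].
    rewrite expf_eq0 subr_eq0 => /andP[_ /eqP <-].
    by rewrite imset_f ?orbT.
  move/subset_leq_card/leq_trans; apply; apply: leq_trans (leq_card_setU _ _) _.
  rewrite cards1 -[X in (_ <= X)%N](prednK n_gt0) add1n ltnS.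
  by apply: leq_trans (leq_imset_card _ _) _; rewrite card_ord.
rewrite -natrX -natrM ler_nat /weil_const mulnDl mulnC -expnM -/s leq_add2l.
by rewrite leq_pmulr // expn_gt0 ltnW.
Qed.

Lemma poly_character_roots : exists ws : seq algC,
  [/\ (size ws < n)%N, Lcoef chi 1 = - \sum_(w <- ws) w & {in ws, forall w, `|w| ^+ 2 <= q%:R}].
Proof.
pose A : {poly algC} := \poly_(i < n) Lcoef chi i.
have coefA i : A`_i = Lcoef chi i.
  by rewrite coef_poly; case: ltnP => // /Lcoef_eq0->.
have Lc0 : Lcoef chi 0 = 1 := Lcoef0 poly_character1.
have [ws Aws szws] := factor_one_sub (etrans (coefA 0%N) Lc0).
have LpE r : Lpower chi r.+1 = - \sum_(w <- ws) w ^+ r.+1.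
  apply: Lpower_eq => [||i]; [exact: poly_character1|exact: poly_characterM|].
  by rewrite -coefA Aws.
exists ws; split.
- by rewrite szws (leq_ltn_trans (_ : _ <= n.-1)%N) ?prednK // -!subn1 leq_sub2r ?size_poly.
- have := Lcoef_recursion poly_character1 poly_characterM 1.
  by rewrite big_nat1 subnn Lc0 mulr1 LpE; under eq_bigr => x _ do rewrite expr1.
move=> x x_ws.
have qn_gt0 : 0 < (q ^ n)%:R :> algC by rewrite ltr0n expn_gt0 ltnW.
(* Power sums are under control only at the multiples of [2 * n], so the bound is applied to the
   powers [y ^+ (2 * n)], and a root is taken afterwards. *)
have := @power_sum_bound [seq y ^+ (2 * n) | y <- ws] weil_const%:R _ qn_gt0.
move=> /(_ _ (x ^+ (2 * n))) bnd.
have : `|x ^+ (2 * n)| <= (q ^ n)%:R.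
  apply: bnd; last exact: map_f.
  move=> t; rewrite big_map; under eq_bigr => u _ do rewrite -exprM.
  have e : (2 * n * t.+1 = (2 * n * t.+1).-1.+1)%N by rewrite prednK // !muln_gt0 n_gt0.
  by rewrite e -normrN -LpE -e; apply: Lpower_bound.
by rewrite normrX exprM natrX ler_pXn2r // nnegrE ?exprn_ge0 ?normr_ge0 ?ler0n.
Qed.

End Character.

Lemma generator_shifts_bound :
  (forall a, (v + j a) ^+ E = 1) -> (q <= n.-1 ^ 2)%N.
Proof.
move=> va1.
have [g prim_g] := finField_prim_root F.
have prim_w : l.-primitive_root (g ^+ E).
  have := dvdn_prim_root prim_g (_ : (l %| #|F|.-1)%N); rewrite lE /= mulKn //; apply.
  exact: dvdn_mulr.
have [zeta prim_zeta] := C_prim_root_exists l_gt0.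
have [ws [szws Lc1 le_ws]] := poly_character_roots prim_w prim_zeta.
(* All the [q] monic linear polynomials take values of character 1 at [v]. *)
have Lc1q : Lcoef (poly_character (g ^+ E) zeta) 1 = q%:R.
  rewrite /Lcoef big_seq (eq_bigr (fun=> 1)) -?big_seq.
    by rewrite big_const_seq count_predT size_map -cardE card_npoly expn1 iter_addr_0.
  move=> f /mapP[t _ ->]; rewrite /poly_character.
  have /size1_polyC -> : (size (val t) <= 1)%N := size_npoly t.
  rewrite rmorphD /= map_polyX map_polyC /= hornerD hornerX hornerC.
  by rewrite (@characterP _ _ _ _ _ l_gt1 prim_w prim_zeta _ 0).
pose rq : algC := sqrtC q%:R.
have rq_gt0 : 0 < rq by rewrite sqrtC_gt0 ltr0n ltnW.
have le_q : q%:R <= (size ws)%:R * rq.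
  rewrite -[X in X <= _](@ger0_norm _ q%:R) ?ler0n // -Lc1q Lc1 normrN.
  apply: le_trans (ler_norm_sum _ _ _) _.
  rewrite mulr_natl -[X in _ <= X]iter_addr_0 -(count_predT ws) -big_const_seq.
  rewrite big_seq [X in _ <= X]big_seq; apply: ler_sum => w /le_ws le_w.
  by rewrite -(@ler_pXn2r _ 2) // ?nnegrE ?(ltW rq_gt0) ?normr_ge0 // sqrtCK.
have le_rq : rq <= (size ws)%:R.
  by rewrite -(ler_pM2r rq_gt0) -expr2 sqrtCK.
rewrite -(ler_nat algC) -[q%:R]sqrtCK natrX ler_pXn2r // ?nnegrE ?ler0n ?(ltW rq_gt0) //.
by apply: le_trans le_rq _; rewrite ler_nat -ltnS prednK.
Qed.

End WeilBound.

(** * Cliques *)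

Section Cliques.
Local Open Scope ring_scope.

Lemma nonzero_powers1 (F : finFieldType) d : 1 \in nonzero_powers F d.
Proof. by apply/imsetP; exists 1; rewrite ?inE ?oner_neq0 ?expr1n. Qed.

Lemma nonzero_powers_div (F : finFieldType) d :
  {in nonzero_powers F d &, forall x y, x / y \in nonzero_powers F d}.
Proof.
move=> _ _ /imsetP[x + ->] /imsetP[y + ->]; rewrite !inE => nx ny.
by apply/imsetP; exists (x / y); rewrite ?inE ?mulf_neq0 ?invr_eq0 // exprMn exprVn.
Qed.

(** The nonzero elements of [H] form a subgroup of a cyclic group; [l] is its index, found as the
    least positive exponent of a generator [g] for which the power lies in [H]. *)
Lemma finField_subgroup_exponent (F : finFieldType) (H : {pred F}) :
  1 \in H -> {in H &, forall x y, x / y \in H} -> (exists2 x, x != 0 & x \notin H) ->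
  exists l e, [/\ (1 < l)%N, #|F| = (l * e).+1 & {in H, forall x, x != 0 -> x ^+ e = 1}].
Proof.
move=> H1 Hdiv [x nz_x xH]; have [g prim_g] := finField_prim_root F.
have F_gt1 : (1 < #|F|)%N := finNzRing_gt1 F.
have HM y z : y \in H -> z \in H -> y * z \in H.
  by move=> Hy Hz; rewrite -[z]invrK Hdiv // -[z^-1]mul1r Hdiv.
have HX y i : y \in H -> y ^+ i \in H.
  by move=> Hy; elim: i => [|i IHi]; rewrite ?expr0 // exprS HM.
have nz_g : g != 0 by rewrite (prim_root_eq0 prim_g) gtn_eqF // -subn1 subn_gt0.
have gE y : y != 0 -> exists i, y = g ^+ i.
  move=> nz_y; have [i ->] : {i : 'I_#|F|.-1 | y = g ^+ i}; last by exists i.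
  apply: (prim_rootP prim_g); apply: (mulfI nz_y).
  by rewrite mulr1 -exprS prednK ?expf_card // ltnW.
have exP : exists i, (0 < i)%N && (g ^+ i \in H).
  by exists #|F|.-1; rewrite (prim_expr_order prim_g) H1 -subn1 subn_gt0 F_gt1.
case: (ex_minnP exP) => l /andP[l_gt0 gl_H] min_l.
have l_dvd i : g ^+ i \in H -> (l %| i)%N.
  move=> Hi; rewrite /dvdn; apply: contraT; rewrite -lt0n => r_gt0.
  suff /min_l : (0 < i %% l)%N && (g ^+ (i %% l) \in H) by rewrite leqNgt ltn_pmod.
  rewrite r_gt0; have := Hdiv _ _ Hi (HX _ (i %/ l)%N gl_H).
  by rewrite {1}(divn_eq i l) exprD mulnC exprM mulrAC mulfV ?mul1r ?expf_neq0.
have /dvdnP[e cardE] : (l %| #|F|.-1)%N by apply: l_dvd; rewrite prim_expr_order.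
exists l, e; split.
- rewrite ltn_neqAle l_gt0 andbT; apply: contraNneq xH => l1.
  by have [i ->] := gE x nz_x; rewrite HX // -[g]expr1 l1.
- by rewrite mulnC -cardE prednK // ltnW.
move=> y Hy /gE[i y_g]; rewrite y_g in Hy *.
have /dvdnP[c ->] := l_dvd _ Hy.
by rewrite -exprM -mulnA [(l * e)%N]mulnC -cardE mulnC exprM (prim_expr_order prim_g) expr1n.
Qed.

Lemma subfield_clique_extension (F : finFieldType) (d n : nat) (K : {set F}) (v : F) :
  is_subfield K -> (0 < n)%N -> #|F| = (#|K| ^ n)%N -> ((n - 1) ^ 2 < #|K|)%N -> v \notin K ->
  (forall a, a \in K -> v - a \in nonzero_powers F d) ->
  exists2 L : {set F}, subfield_clique (GP F d) L & K \proper L.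
Proof.
move=> Kf n_gt0 cardF lt_nK vK vaH.
pose k : finFieldType := subfield_type Kf.
pose jk : {rmorphism k -> F} := (val : {rmorphism subfield_type Kf -> F}).
have cardk : #|k| = #|K| := card_subfield_type Kf.
pose q := #|K|.
have exP : exists i, (0 < i)%N && (v ^+ (q ^ i) == v).
  by exists n; rewrite n_gt0 -cardF expf_card eqxx.
(* [m] is the degree of [v] over [K], and the fixed points of the power [q ^ m] are [K(v)]. *)
case: (ex_minnP exP) => m /andP[m_gt0 /eqP vm] min_m.
have le_mn : (m <= n)%N by apply: min_m; rewrite n_gt0 -cardF expf_card eqxx.
have pF : [pchar F].-nat (q ^ m)%N.
  by rewrite pnatX /q -cardk (pchar_nat_card_ext jk).
have Lf := fixed_subfield pF; set L := [set x | _] in Lf.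
have KL a : a \in K -> a \in L.
  move=> aK; rewrite inE; have := expf_card_iter (Sub a aK : k) m.
  by move/(congr1 jk); rewrite rmorphXn cardk => /eqP.
have vL : v \in L by rewrite inE vm.
have properKL : K \proper L.
  apply/properP; split; first by apply/subsetP.
  by exists v.
exists L => //; split=> //.
pose lT : finFieldType := subfield_type Lf.
pose jl : {rmorphism lT -> F} := (val : {rmorphism subfield_type Lf -> F}).
have [j jE] : exists j' : {rmorphism k -> lT}, forall x, jl (j' x) = jk x.
  by apply: (subfield_type_lift Lf (j := jk)) => x; apply/KL/(valP x).
pose v' : lT := Sub v vL.
have jlv : jl v' = v by [].
have v'm : v' ^+ (#|k| ^ m) = v' by apply: (fmorph_inj jl); rewrite rmorphXn cardk jlv vm.
have v'_gen o : (0 < o < m)%N -> v' ^+ (#|k| ^ o) != v'.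
  case/andP=> o_gt0 lt_om; apply: contraL lt_om => /eqP/(congr1 jl) vo.
  rewrite -leqNgt min_m // o_gt0; apply/eqP.
  by move: vo; rewrite rmorphXn cardk jlv.
have cardL : #|lT| = (#|k| ^ m)%N.
  apply/eqP; rewrite eqn_leq; apply/andP; split; last first.
    by have := leq_card _ (frobenius_orbit_eval_inj (j := j) v'm v'_gen); rewrite card_npoly.
  rewrite [#|lT|]card_subfield_type cardk cardE -ltnS.
  have q_gt1 : (1 < q)%N by rewrite /q -cardk finNzRing_gt1.
  have szX : size ('X^(q ^ m) - 'X : {poly F}) = (q ^ m).+1.
    by rewrite size_polyDl ?size_polyXn // size_polyN size_polyX ltnS
      (leq_trans q_gt1) // -[X in (X <= _)%N]expn1 leq_exp2l.
  rewrite -szX; apply: max_poly_roots; last exact: enum_uniq.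
    by rewrite -size_poly_eq0 szX.
  by apply/allP => x; rewrite mem_enum inE /root !hornerE subr_eq0.
(* These are [d]-th powers in [F], not in the subfield, so the index of [H] need not be related to
   [d]; only its being larger than 1 matters, and the missing difference [x - y] ensures that. *)
pose H : {pred lT} := [pred x | jl x \in nonzero_powers F d].
have HE x : (x \in H) = (jl x \in nonzero_powers F d) by [].
move=> x y xL yL ne_xy; rewrite /GP /Cay; apply: contraT => xyH.
have xyL : x - y \in L by have [_ LB _] := Lf; apply: LB.
have [|||l [e [l_gt1 lE He]]] := @finField_subgroup_exponent lT H.
- by rewrite HE rmorph1 nonzero_powers1.
- by move=> a b; rewrite !HE fmorph_div; apply: nonzero_powers_div.
- exists (Sub (x - y) xyL : lT); rewrite ?inE //.
  by rewrite -val_eqE /= subr_eq0.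
have := generator_shifts_bound (j := j) m_gt0 cardL v'_gen l_gt1 lE.
rewrite cardk => /(_ _) bnd; suff : (#|K| <= (n - 1) ^ 2)%N by rewrite leqNgt lt_nK.
have -> // : (#|K| <= m.-1 ^ 2)%N -> (#|K| <= (n - 1) ^ 2)%N.
  by move/leq_trans; apply; rewrite leq_exp2r // subn1 -!subn1 leq_sub2r.
apply: bnd => a.
have vaHa : jl (v' + j a) \in nonzero_powers F d.
  rewrite rmorphD jE jlv -[jk a]opprK vaH // -rmorphN; exact: (valP (- a : subfield_type Kf)).
apply: He; first by rewrite HE.
by apply: contraTneq vaHa => ->; rewrite rmorph0 nonzero_powers_neq0.
Qed.

End Cliques.

Unset Implicit Arguments.

(* F is (any model of) the field of order q ^ n, and K its subfield of order q,
   given as a subset of F. *)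
Theorem theorem1p2 (d n p k q : nat) (F : finFieldType) (K : {set F})
    (d_gt1 : 1 < d) (n_gt0 : 1 <= n)
    (p_pr : prime p) (p_odd : odd p) (k_gt0 : 0 < k) (qE : q = p ^ k)
    (q_mod : q ^ n = 1 %[mod 2 * d]) (q_gt : (n - 1) ^ 2 < q)
    (cardF : #|F| = q ^ n)
    (K_subfield : is_subfield K) (cardK : #|K| = q) :
  maximal_subfield_clique (GP F d) K -> maximal_clique (GP F d) K.
Proof.
case=> -[_ clK] maxK; split=> // D clD; apply/negP => /properP[sKD [v vD vK]].
have [L clL properKL] : exists2 L : {set F}, subfield_clique (GP F d) L & K \proper L.
  apply: (subfield_clique_extension K_subfield n_gt0 _ _ vK); rewrite ?cardK // => a aK.
  apply: clD => //; first exact: (subsetP sKD).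
  by apply: contraNneq vK => ->.
by have := maxK L clL; rewrite properKL.
Qed.
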